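(* Let $\mu>0$ and let $u^*\in BV(\Omega)$ be a solution of the ROF model $$\min_{u\in BV(\Omega)}\Big\{TV(u)+\frac{\mu}{2}\int_\Omega (u-f)^2\,dx\Big\}.$$ For given $0<m_0<m_1\le 1$, let $\tilde\Sigma:=\{x\in\Omega: u^*(x)>\frac{m_1+m_0}{2}\}$ fulfill $0<|\tilde\Sigma|<|\Omega|$. Then $\tilde\Sigma$ is a minimizer of $E_{\rm CV}(\cdot,m_0,m_1)$ (over measurable subsets of $\Omega$, with $m_0,m_1$ fixed) for the parameter $\lambda:=\frac{\mu}{2(m_1-m_0)}$. In particular, $(\tilde\Sigma,m_0,m_1)$ is a partial minimizer of $E_{\rm CV}$ (with this $\lambda$) if $m_0={\rm mean}_f(\Omega\setminus\tilde\Sigma)$ and $m_1={\rm mean}_f(\tilde\Sigma)$.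
   Context: Throughout, $\Omega\subset\mathbb R^2$ is a bounded open set with Lipschitz boundary and $f:\Omega\to[0,1]$ is a given (measurable) image. $|A|$ is Lebesgue measure; sets are Lebesgue measurable and considered up to measure zero. $TV(u)=\sup\{\int_\Omega u\,{\rm div}\varphi\,dx:\varphi\in C_c^1(\Omega,\mathbb R^2),\|\varphi\|_\infty\le1\}$; $BV(\Omega)$ is the set of functions $u:\Omega\to[0,1]$ with $\|u\|_{L^1(\Omega)}+TV(u)<\infty$; ${\rm Per}(A;\Omega):=TV(\chi_A)$. ${\rm mean}_f(A):=\frac1{|A|}\int_A f\,dx$ if $|A|>0$ and $0$ otherwise. The two-phase piecewise constant Mumford–Shah (Chan–Vese) functional with parameter $\lambda>0$ is $$E_{\rm CV}(\Sigma,m_0,m_1)={\rm Per}(\Sigma;\Omega)+\lambda\Big(\int_\Sigma(m_1-f)^2dx+\int_{\Omega\setminus\Sigma}(m_0-f)^2dx\Big),$$ for measurable $\Sigma\subseteq\Omega$ and real $m_0,m_1$. A triple $(\Sigma^*,m_0^*,m_1^* )$ is a partial minimizer of $E_{\rm CV}$ if $E_{\rm CV}(\Sigma^*,m_0^*,m_1^* )\le E_{\rm CV}(\Sigma^*,m_0,m_1)$ for all $m_0,m_1$ and $E_{\rm CV}(\Sigma^*,m_0^*,m_1^* )\le E_{\rm CV}(\Sigma,m_0^*,m_1^* )$ for all $\Sigma$. *)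

(* Defs.v *)
From HB Require Import structures.
From mathcomp Require Import all_boot all_order all_algebra.
From mathcomp Require Import all_classical all_reals all_analysis.

Set Implicit Arguments.
Unset Strict Implicit.
Unset Printing Implicit Defensive.
Import Order.TTheory GRing.Theory Num.Theory.
Import numFieldNormedType.Exports.

Local Open Scope classical_set_scope.
Local Open Scope ring_scope.

(* [lebesgue_measure] lives on the Borel sigma-algebra of R.  Lebesgue
   measurable subsets of the plane are the Caratheodory-measurable sets of the
   outer measure induced by the Borel product measure, that is, the completion
   of the Borel sigma-algebra.  [leb_plane R] is convertible to [R * R]. *)
Notation borel_area R :=
  ((@lebesgue_measure R) \x (@lebesgue_measure R))%E (only parsing).

Notation leb_plane R := (caratheodory_type (borel_area R)^*%mu).

Definition area (R : realType) : set (leb_plane R) -> \bar R :=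
  @completed_measure_extension _ _ R (borel_area R).

HB.instance Definition _ (R : realType) := Measure.on (@area R).

Section planar_domains.
Context (R : realType).
Implicit Types (Omega : set (R * R)).

(* Near each boundary point, after a rotation of the axes by the angle with
   cosine c and sine s, Omega is the open epigraph of a Lipschitz function. *)
Definition lipschitz_boundary Omega :=
  forall p : R * R, closure Omega p -> ~ interior Omega p ->
  exists (c s : R) (gamma : R -> R),
    [/\ c ^+ 2 + s ^+ 2 = 1,
        lipschitz gamma &
        \forall q \near p,
          Omega q <-> gamma (c * q.1 + s * q.2) < - s * q.1 + c * q.2].

End planar_domains.

Section total_variation.
Context (R : realType).
Implicit Types (phi : R * R -> R * R) (Omega : set (R * R)) (u : R * R -> R).

Definition e1 : R * R := (1, 0).
Definition e2 : R * R := (0, 1).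

Definition C1_field phi :=
  [/\ forall x, derivable phi x e1, forall x, derivable phi x e2,
      continuous (fun x => 'D_e1 phi x) & continuous (fun x => 'D_e2 phi x)].

Definition divergence phi (x : R * R) : R :=
  ('D_e1 phi x).1 + ('D_e2 phi x).2.

(* The norm of the library on [R * R] is the max norm; the pointwise norm in
   the (isotropic) total variation is the Euclidean one. *)
Definition eucl_norm (v : R * R) : R := Num.sqrt (v.1 ^+ 2 + v.2 ^+ 2).

(* Elements of C_c^1(Omega, R^2) are represented by their extension by zero to
   the whole plane. *)
Definition test_field Omega phi :=
  [/\ C1_field phi,
      compact (closure [set x | phi x != 0]),
      closure [set x | phi x != 0] `<=` Omega &
      forall x, eucl_norm (phi x) <= 1].

Definition TV Omega u : \bar R :=
  ereal_sup [set (\int[@area R]_(x in Omega) (u x * divergence phi x)%:E)%E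
            | phi in test_field Omega].

Definition Per (A Omega : set (R * R)) : \bar R := TV Omega \1_A.

Definition leb_measurable_fun Omega u :=
  measurable_fun (Omega : set (leb_plane R)) (u : leb_plane R -> R).

(* Functions on Omega are represented by functions on the plane, of which only
   the restriction to Omega matters. *)
Definition unit_valued Omega u := forall x, Omega x -> 0 <= u x <= 1.

Definition BV Omega u :=
  [/\ leb_measurable_fun Omega u,
      unit_valued Omega u &
      (\int[@area R]_(x in Omega) `|u x|%:E + TV Omega u < +oo)%E].

End total_variation.

Section functionals.
Context (R : realType) (Omega : set (R * R)) (f : R * R -> R).
Implicit Types (u : R * R -> R) (Sigma : set (R * R)) (m : R).

Definition ROF (mu : R) u : \bar R :=
  (TV Omega u +
   (mu / 2)%:E * \int[@area R]_(x in Omega) ((u x - f x) ^+ 2)%:E)%E.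

Definition ROF_solution (mu : R) u :=
  BV Omega u /\ forall v, BV Omega v -> (ROF mu u <= ROF mu v)%E.

Definition mean (A : set (R * R)) : R :=
  if (0 < area (A : set (leb_plane R)))%E then
    (fine (area (A : set (leb_plane R))))^-1 * \int[@area R]_(x in A) f x
  else 0.

Definition E_CV (lambda : R) Sigma (m0 m1 : R) : \bar R :=
  (Per Sigma Omega +
   lambda%:E * (\int[@area R]_(x in Sigma) ((m1 - f x) ^+ 2)%:E +
                \int[@area R]_(x in Omega `\` Sigma) ((m0 - f x) ^+ 2)%:E))%E.

Definition measurable_part Sigma :=
  measurable (Sigma : set (leb_plane R)) /\ Sigma `<=` Omega.

Definition E_CV_minimizer (lambda : R) Sigma (m0 m1 : R) :=
  measurable_part Sigma /\
  forall Sigma', measurable_part Sigma' ->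
    (E_CV lambda Sigma m0 m1 <= E_CV lambda Sigma' m0 m1)%E.

Definition E_CV_partial_minimizer (lambda : R) Sigma (m0 m1 : R) :=
  [/\ measurable_part Sigma,
      forall m0' m1' : R,
        (E_CV lambda Sigma m0 m1 <= E_CV lambda Sigma m0' m1')%E &
      forall Sigma', measurable_part Sigma' ->
        (E_CV lambda Sigma m0 m1 <= E_CV lambda Sigma' m0 m1)%E].

End functionals.

(* Main.v *)
Require Import Defs.
From HB Require Import structures.
From mathcomp Require Import all_boot all_order all_algebra.
From mathcomp Require Import all_classical all_reals all_analysis.
From mathcomp Require Import measurable_realfun.
From mathcomp Require Import ring lra.
Set Implicit Arguments.
Unset Strict Implicit.
Unset Printing Implicit Defensive.
Import Order.TTheory GRing.Theory Num.Theory.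
Import numFieldNormedType.Exports.
Local Open Scope classical_set_scope.
Local Open Scope ring_scope.

(** The heart of the matter is a one-sided coarea inequality: if g is
    nondecreasing and 1-Lipschitz, then TV (g u) + TV (u - g u) <= TV u.  For
    smooth u and test fields phi, psi, the interpolated field
    theta = g'(u) phi + (1 - g'(u)) psi is again a test field, and integration by
    parts turns the integral of u div theta into the sum of the integrals of
    g(u) div phi and (u - g(u)) div psi.  A general u is replaced by its averages
    over small segments in the coordinate directions: averaging twice in each
    direction gives a C^1 function w; the integral of w div theta is a mean of
    integrals of u against the divergences of translates of theta, hence at most
    TV u; and the averages converge by Lebesgue's differentiation theorem.

    Now let G be a smooth approximation of the indicator of ]s, +oo[, with
    s = (m0 + m1) / 2.  For small eta > 0 the function
    u - eta (G u - G 0) + eta (G 1 - G 0) 1_Sigma' has values in [0, 1].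
    Comparing its ROF energy with that of u, dividing by eta and passing to the
    limit in G gives Per {u > s} <= Per Sigma' + mu * int (u - f) (1_Sigma' - 1_{u > s}),
    and u may be replaced by s in the integrand because
    (u - s) (1_Sigma' - 1_{u > s}) <= 0.  This is the minimality of {u > s} for
    the Chan-Vese functional, and the mean value of f on a set is its best
    constant least-squares approximation there. *)

(** * Lebesgue measure of the plane *)

(** Only an upper bound for the energy of the competitor is used, so a one-sided inequality
    suffices: subtracting [eta (G u - G 0)] gains the whole variation of that term, and adding a
    multiple of an indicator costs at most the same multiple of its perimeter. The quadratic
    fidelity term contributes to second order in eta only, so dividing by eta linearizes it.

    The obstacle is that theta contains g'(u), so that its divergence contains the gradient of u,
    which need not be a function; hence the detour through w. Segment averages keep the analysis
    one-dimensional: the fundamental theorem of calculus differentiates them, and they commute with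
    each other. Translates of theta remain test fields as long as the shift is small with respect to
    the supports of phi and psi, a condition that does not involve w. The bound by TV u is therefore
    uniform in the averaging lengths, which can tend to 0 one after another.

    Fubini's theorem and translations are applied to Borel functions of the plane, whereas u is only
    Lebesgue measurable; this part of the argument is run for a Borel function that equals u almost
    everywhere in Omega. *)

Local Notation line R := (measurableTypeR R).
Local Notation plane R := (measurableTypeR R * measurableTypeR R)%type.

Section plane_measurability.
Context {R : realType}.
Implicit Types (U : set (R * R)) (f : R * R -> R).

Lemma open_measurable_plane U : open U -> measurable (U : set (plane R)).
Proof.
move=> oU.
pose box (i : (rat * rat) * (rat * rat)) : set (plane R) :=
  (`](ratr i.1.1 : R), ratr i.1.2[%classic `*` `](ratr i.2.1 : R), ratr i.2.2[%classic).
(* Boxes not contained in [U] are replaced by the empty set, so that the union runs over a fixed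
   countable type. *)
pose F i : set (plane R) := if `[< box i `<=` U >] then box i else set0.
have -> : U = \bigcup_i F i.
  apply/seteqP; split => [[x y] Up|p [i _]]; last first.
    by rewrite /F; case: asboolP => // + Fp; exact.
  have /nbhs_ballP[e /= e0 peU] := open_nbhs_nbhs (conj oU Up).
  have [a] := @rat_in_itvoo R (x - e) x ltac:(lra).
  have [b] := @rat_in_itvoo R x (x + e) ltac:(lra).
  have [c] := @rat_in_itvoo R (y - e) y ltac:(lra).
  have [d] := @rat_in_itvoo R y (y + e) ltac:(lra).
  rewrite !in_itv/= => /andP[d1 d2] /andP[c1 c2] /andP[b1 b2] /andP[a1 a2].
  exists ((a, b), (c, d)) => //; rewrite /F; case: asboolP => [_|].
    by split; rewrite /= in_itv/=; apply/andP.
  move=> []; move=> [x' y'] [/=]; rewrite !in_itv/= => /andP[? ?] /andP[? ?].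
  apply: peU; split; rewrite /ball/= ltr_norml; lra.
apply: countable_bigcupT_measurable => // i; rewrite /F; case: ifPn => // _.
by apply: measurableX; exact: measurable_itv.
Qed.

Lemma continuous_measurable_plane f : continuous f ->
  measurable_fun (setT : set (plane R)) f.
Proof.
move=> cf; apply: (measurability _ (RGenOpens.measurableE R)) => _ [_ [a [b ->] <-]].
rewrite setTI; apply: open_measurable_plane.
by move/continuousP : cf; apply; exact: interval_open.
Qed.

End plane_measurability.

Section measure_preserving.
Context d d' (X : measurableType d) (Y : measurableType d') {R : realType}
  (m : {measure set X -> \bar R}) (m' : {measure set Y -> \bar R}).
Variable tau : X -> Y.
Hypothesis mtau : measurable_fun setT tau.
Hypothesis tauP : forall A, measurable A -> m (tau @^-1` A) = m' A.

(** The positive and the negative part are transported separately, which also covers functions that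
    are not integrable. *)
Lemma integral_preserving (f : Y -> \bar R) : measurable_fun setT f ->
  (\int[m]_x f (tau x) = \int[m']_x f x)%E.
Proof.
have ge0 (g : Y -> \bar R) : measurable_fun setT g -> (forall x, 0 <= g x)%E ->
    (\int[m]_x g (tau x) = \int[m']_x g x)%E.
  move=> mg g0; rewrite -(@ge0_integral_pushforward _ _ _ _ _ _ mtau m setT)//.
  by apply: eq_measure_integral => A mA _; exact: tauP.
move=> mf; rewrite integralE [RHS]integralE.
rewrite -(ge0 _ (measurable_funepos mf) (funepos_ge0 f)).
rewrite -(ge0 _ (measurable_funeneg mf) (funeneg_ge0 f)).
congr (_ - _)%E; apply: eq_integral => x _.
  by rewrite (funepos_comp f tau).
by rewrite (funeneg_comp f tau).
Qed.

End measure_preserving.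

Section translations.
Context {R : realType}.
Implicit Types (a : R) (z : R * R).
Local Notation mu := (@lebesgue_measure R).

Lemma measurable_shift_line a : measurable_fun setT (fun x : line R => x + a : line R).
Proof. by apply: measurable_funD => //; exact: measurable_cst. Qed.

Lemma lebesgue_measure_shift a (A : set (line R)) : measurable A ->
  mu ((fun x : line R => x + a : line R) @^-1` A) = mu A.
Proof.
move=> mA; apply/esym.
apply: (@lebesgue_measure_unique _ (pushforward mu (fun x : line R => x + a : line R))) => //.
  exact: measurable_shift_line.
move=> _ _ [[b c] _ <-] /=; rewrite /pushforward.
rewrite (_ : _ @^-1` _ = `]b - a, c - a]%classic); last first.
  by apply/seteqP; split=> x /=; rewrite !in_itv/= lerBrDr ltrBlDr.
rewrite !lebesgue_measure_itv/= !lte_fin ltrD2r.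
by case: ifP => // _; rewrite -!EFinB; congr EFin; lra.
Qed.

Lemma measurable_shift_plane z :
  measurable_fun setT (fun x : plane R => x + z : plane R).
Proof.
apply: (@measurable_fun_pair _ _ _ _ _ _ (fun x : plane R => x.1 + z.1 : line R)
  (fun x : plane R => x.2 + z.2 : line R)).
  by apply: (measurableT_comp (measurable_shift_line z.1)); exact: measurable_fst.
by apply: (measurableT_comp (measurable_shift_line z.2)); exact: measurable_snd.
Qed.

Lemma plane_measure_shift z (A : set (plane R)) : measurable A ->
  (borel_area R) ((fun x : plane R => x + z : plane R) @^-1` A) = (borel_area R) A.
Proof.
move=> mA; apply/esym.
apply: (@product_measure_unique _ _ _ _ _ _ _
  (pushforward (borel_area R) (fun x : plane R => x + z : plane R))) => //.
  exact: measurable_shift_plane.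
move=> hm B C mB mC; rewrite /= /pushforward.
rewrite (_ : _ @^-1` _ = ((fun x : line R => x + z.1 : line R) @^-1` B) `*`
  ((fun x : line R => x + z.2 : line R) @^-1` C)); last first.
  by apply/seteqP; split.
rewrite product_measure1E.
- by congr (_ * _)%E; exact: lebesgue_measure_shift.
- by rewrite -[X in measurable X]setTI; exact: measurable_shift_line.
- by rewrite -[X in measurable X]setTI; exact: measurable_shift_line.
Qed.

End translations.

Section bounded_on_segments.
Context {R : realType}.
Local Notation mu := (@lebesgue_measure R).

Lemma bounded_line_integrable (k : R -> R) M (a b : R) :
  measurable_fun setT k -> (forall s, `|k s| <= M) ->
  mu.-integrable `[a, b] (EFin \o k).
Proof.
move=> mk kM; apply: measurable_bounded_integrable => //.
- by rewrite [X in (X < _)%E]lebesgue_measure_itv/=; case: ifP => _; rewrite ?ltry.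
- exact: measurable_funTS.
- exists `|M|; split; first exact: num_real.
  by move=> x Mx s _ /=; rewrite (le_trans (kM s))// (le_trans (ler_norm M))// ltW.
Qed.

Lemma Rintegral_itv_cst a (c : R) : 0 < a -> \int[mu]_(s in `[0, a]) c = a * c.
Proof.
move=> a0; rewrite Rintegral_cst; last exact: measurable_itv.
have E : mu (`[0, a]%classic : set R) = a%:E.
  by rewrite lebesgue_measure_itv/= lte_fin a0 oppr0 adde0.
by rewrite [fine _](congr1 fine E)/= mulrC.
Qed.

End bounded_on_segments.

(** * Fubini's theorem on the product with a segment *)

Section fubini_dominated.
Context d (T : measurableType d) {R : realType}
  (m0 : {measure set T -> \bar R}) (m0_sfin : sigma_finite setT m0).
(** A local name for the measure, to which the hypothesis of sigma-finiteness can be attached as an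
    instance. *)
Let m : set T -> \bar R := m0.
HB.instance Definition _ := Measure.on m.
HB.instance Definition _ := Measure_isSigmaFinite.Build _ _ _ m m0_sfin.
Local Notation mu := (@lebesgue_measure R).

(** Tonelli's theorem gives integrability on the product, since the integral of the absolute value
    over the segment is at most [H] times its length. Both partial integrals are claimed to be
    integrable because later comparisons of real-valued integrals depend on it. *)
Lemma dominated_Rfubini (G : T -> R -> R) (H : T -> R) (a : R) :
  measurable_fun setT (fun p : T * line R => G p.1 p.2) ->
  (forall x s, 0 <= s <= a -> `|G x s| <= H x) ->
  m0.-integrable setT (EFin \o H) ->
  [/\ m0.-integrable setT (fun x => (\int[mu]_(s in `[0, a]) G x s)%:E),
      mu.-integrable `[0, a] (fun s => (\int[m0]_x G x s)%:E) &
      \int[m0]_x (\int[mu]_(s in `[0, a]) G x s) =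
      \int[mu]_(s in `[0, a]) (\int[m0]_x G x s)].
Proof.
move=> mG GH iH; rewrite -/m; pose I : set (line R) := `[0, a]%classic.
have mI : measurable I by exact: measurable_itv.
(* The indicator moves the restriction to the segment into the integrand, so that Fubini applies on
   the whole product. *)
pose F (p : T * line R) : \bar R := (G p.1 p.2 * \1_I p.2)%:E.
have mF : measurable_fun setT F.
  apply/measurable_EFinP; apply: measurable_funM => //.
  by apply: measurableT_comp; [exact: measurable_indic|exact: measurable_snd].
have FE x s : F (x, s) = ((fun s => (G x s)%:E) \_ I) s.
  by rewrite /F/= patchE indicE; case: ifPn => _; rewrite ?mulr1 ?mulr0.
have mGx x : measurable_fun setT (fun s : line R => G x s).
  exact: (measurableT_comp mG (measurable_pair1 x)).
have mGs s : measurable_fun setT (fun x => G x s).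
  exact: (measurableT_comp mG (measurable_pair2 s)).
have mH : measurable_fun setT H by apply/measurable_EFinP; exact: (measurable_int m).
have muI : (mu I < +oo)%E.
  by rewrite /I lebesgue_measure_itv/=; case: ifP => _; rewrite ?ltry.
have iF : (m \x mu)%E.-integrable setT F.
  apply: (proj2 (@integrable12ltyP _ _ _ _ _ m mu F mF)).
  apply: (@le_lt_trans _ _ (\int[m]_x (`|(H x)%:E| * mu I))%E).
    apply: ge0_le_integral => //.
    - by move=> x _; exact: integral_ge0.
    - apply: (measurable_fun_fubini_tonelli_F (abse \o F)) => //=.
      exact: measurableT_comp.
    - apply: emeasurable_funM => //; apply/measurable_EFinP.
      by apply: measurableT_comp => //.
    - move=> x _; rewrite (eq_integral (fun s => ((fun s => `|(G x s)%:E|%E) \_ I) s)); last first.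
        by move=> s _; rewrite FE !patchE; case: ifP => // _; rewrite abse0.
      rewrite -integral_mkcond -integral_cst//; apply: ge0_le_integral => //.
      - apply: measurable_funTS; apply: measurableT_comp => //.
        exact/measurable_EFinP.
      - move=> s /= sI; rewrite lee_fin (le_trans (GH x s _)) ?ler_norm//.
  rewrite ge0_integralZr//; last by apply: measurableT_comp => //; exact/measurable_EFinP.
  rewrite lte_mul_pinfty//; first exact: integral_ge0.
  by move/integrableP : iH => [_]; rewrite ge0_fin_numE//; exact: integral_ge0.
have in1 x : mu.-integrable I (fun s => (G x s)%:E).
  apply: (@le_integrable _ _ _ _ _ mI _ (cst (H x)%:E)).
  - by apply/measurable_EFinP; exact: measurable_funTS.
  - by move=> s; rewrite /I/= in_itv/= => sI; rewrite lee_fin (le_trans (GH x s _)) ?ler_norm.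
  - apply/integrableP; split; first exact: measurable_cst.
    by rewrite integral_cst// lte_mul_pinfty// ltry.
have in2 s : I s -> m.-integrable setT (fun x => (G x s)%:E).
  move=> sI; apply: (le_integrable _ _ _ iH) => //; first exact/measurable_EFinP.
  by move=> x _; rewrite lee_fin (le_trans (GH x s _)) ?ler_norm//; move: sI; rewrite /I/= in_itv.
have E1 x : (\int[mu]_s F (x, s) = (\int[mu]_(s in I) G x s)%:E)%E.
  rewrite (eq_integral (fun s => ((fun s => (G x s)%:E) \_ I) s)); last by move=> s _; rewrite FE.
  by rewrite -integral_mkcond /Rintegral fineK//; exact: integrable_fin_num.
have E2 : (fun s => \int[m]_x F (x, s))%E = (fun s => (\int[m]_x G x s)%:E) \_ I.
  apply/funext => s; rewrite patchE; case: ifPn => sI.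
    rewrite (eq_integral (fun x => (G x s)%:E)); last by move=> x _; rewrite FE patchE sI.
    by rewrite /Rintegral fineK//; apply: integrable_fin_num => //; apply: in2; rewrite -in_setE.
  by apply: integral0_eq => x _; rewrite FE patchE (negbTE sI).
split.
- apply: (eq_integrable measurableT (fubini_F mu F)); last exact: integrable_fubini_F.
  by move=> x _; rewrite /fubini_F E1.
- pose K := fine (\int[m]_x `|(H x)%:E|)%E.
  have KE : (K%:E = \int[m]_x `|(H x)%:E|)%E.
    by rewrite fineK// ge0_fin_numE ?integral_ge0//; move/integrableP : iH => [].
  apply: (@le_integrable _ _ _ _ _ mI _ (cst K%:E)).
  + have /(@measurable_fubini_G _ _ _ _ _ m mu F) mFG := iF.
    apply: (eq_measurable_fun (fubini_G m F)); last exact: measurable_funTS.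
    by move=> s sI; rewrite /fubini_G [LHS](congr1 (@^~ s) E2) patchE sI.
  + move=> s sI; rewrite /cst KE (@gee0_abs _ (\int[m]_x `|(H x)%:E|)%E) ?integral_ge0//.
    rewrite /Rintegral fineK; last by apply: integrable_fin_num => //; exact: in2.
    apply: (le_trans (le_abse_integral _ _ _)) => //; first exact/measurable_EFinP.
    apply: ge0_le_integral => //.
    * by apply: measurableT_comp => //; exact/measurable_EFinP.
    * by apply: measurableT_comp => //; exact/measurable_EFinP.
    * by move=> x _; rewrite lee_fin (le_trans (GH x s _)) ?ler_norm//.
  + exact: (@bounded_line_integrable _ (cst K) `|K|).
- rewrite /Rintegral; congr fine.
  rewrite (eq_integral (fun x => \int[mu]_s F (x, s))%E); last by move=> x _; rewrite E1.
  rewrite [LHS](@Fubini _ _ _ _ _ m mu F iF).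
  by rewrite [X in integral _ _ X](E2 : _ = _) -integral_mkcond.
Qed.

End fubini_dominated.

(** * Averages along segments *)

Lemma borel_area_sigma_finite (R : realType) : sigma_finite setT (borel_area R).
Proof.
pose I n : set (line R) := `[- n%:R, n%:R]%classic.
have mI n : measurable (I n) by exact: measurable_itv.
have finI n : ((@lebesgue_measure R) (I n) < +oo)%E.
  by rewrite /I [X in (X < _)%E]lebesgue_measure_itv/=; case: ifP => _; rewrite ?ltry.
exists (fun n => I n `*` I n).
  apply/esym/seteqP; split => // -[x y] _.
  have [n nx] : exists n : nat, `|x| + `|y| <= n%:R.
    exists (Num.truncn (`|x| + `|y|)).+1; apply/ltW/truncnS_gt.
  by exists n => //; split; rewrite /I /= in_itv/= -ler_norml (le_trans _ nx)// ?lerDl ?lerDr.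
move=> n; split; first exact: measurableX.
rewrite [X in (X < _)%E]product_measure1E// lte_mul_pinfty//.
  by rewrite ge0_fin_numE//; exact: finI.
exact: finI.
Qed.

Section averages.
Context {R : realType}.
Implicit Types (a : R) (z x : R * R) (v h : R * R -> R).
Local Notation mu := (@lebesgue_measure R).
Local Notation mu2 := (borel_area R).

Definition borel v := measurable_fun (setT : set (plane R)) v.

(** Bounded Borel functions that vanish off a square, packed into one inequality. They are the
    weights against which bounded functions are integrated; divergences of test fields are the main
    instance. *)
Definition tame h := borel h /\ exists M B : R,
  forall x, `|h x| <= M * \1_[set y : R * R | `|y.1| <= B /\ `|y.2| <= B] x.

(** A one-sided mean: for continuous [v] its derivative along [z] is the forward difference quotient
    of [v] over the segment. *)
Definition avg z a v x : R := a^-1 * \int[mu]_(s in `[0, a]) v (x + s *: z).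

Lemma box_integrable (M B : R) : mu2.-integrable setT
  (EFin \o (fun x : R * R => M * \1_[set y : R * R | `|y.1| <= B /\ `|y.2| <= B] x)).
Proof.
pose BB : set (plane R) := `[- B, B]%classic `*` `[- B, B]%classic.
have E : [set y : R * R | `|y.1| <= B /\ `|y.2| <= B] = BB.
  by rewrite /BB; apply/seteqP; split=> x /=; rewrite !in_itv/= !ler_norml.
have mE : measurable BB by apply: measurableX; exact: measurable_itv.
have finE : (mu2 BB < +oo)%E.
  rewrite [X in (X < _)%E]product_measure1E// [X in (X * _)%E]lebesgue_measure_itv/=.
  by case: ifP => _; rewrite ?mul0e// [X in (_ * X)%E]lebesgue_measure_itv/=; case: ifP => _;
    rewrite ?mule0// -EFinB -EFinM ltry.
have : mu2.-integrable BB (EFin \o cst M).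
  apply: measurable_bounded_integrable => //.
  exists `|M|; split; first exact: num_real.
  by move=> x Mx s _ /=; rewrite ltW.
move/(integrable_mkcond _ mE); apply: eq_integrable => // x _.
by rewrite patchE E /= indicE; case: ifPn => _; rewrite ?mulr1 ?mulr0.
Qed.

Lemma tame_integrable h : tame h -> mu2.-integrable setT (EFin \o h).
Proof.
move=> [bh [M [B hMB]]]; apply: (le_integrable _ _ _ (box_integrable M B)) => //.
  exact/measurable_EFinP.
by move=> x _; rewrite lee_fin (le_trans (hMB x))// ler_norm.
Qed.

Lemma tame_shift h z : tame h -> tame (fun x => h (x + z)).
Proof.
move=> [bh [M [B hMB]]]; split.
  by apply: (measurableT_comp bh); exact: measurable_shift_plane.
exists (`|M|), (B + `|z.1| + `|z.2|) => x.
apply: (le_trans (hMB _)); rewrite !indicE.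
have [|_] := boolP (x + z \in _); last by rewrite mulr0 mulr_ge0.
rewrite inE/= => -[h1 h2]; rewrite mem_set ?mulr1 ?ler_norm//=; split.
  have := ler_normB (x.1 + z.1) z.1; rewrite addrK => h3.
  by apply: (le_trans h3); have := normr_ge0 z.2; lra.
have := ler_normB (x.2 + z.2) z.2; rewrite addrK => h3.
by apply: (le_trans h3); have := normr_ge0 z.1; lra.
Qed.

(** All translates along a segment share one integrable majorant, a multiple of the indicator of an
    enlarged square; this is the domination that [dominated_Rfubini] asks for. *)
Lemma tame_dominated h z : tame h -> exists2 H : R * R -> R,
  mu2.-integrable setT (EFin \o H) & forall x s, 0 <= s <= 1 -> `|h (x + s *: z)| <= H x.
Proof.
move=> [_ [M [B hMB]]]; pose B' := B + `|z.1| + `|z.2|.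
exists (fun x => `|M| * \1_[set y : R * R | `|y.1| <= B' /\ `|y.2| <= B'] x).
  exact: box_integrable.
move=> x s s01; apply: (le_trans (hMB _)); rewrite !indicE.
have [|_] := boolP (x + s *: z \in _); last by rewrite mulr0 mulr_ge0.
rewrite inE/= => -[h1 h2]; rewrite mem_set ?mulr1 ?ler_norm//=.
have sz (w : R) : `|s * w| <= `|w|.
  by rewrite normrM ler_piMl// ger0_norm; case/andP: s01.
split.
  have := ler_normB (x.1 + s *: z.1) (s *: z.1); rewrite addrK => h3.
  apply: (le_trans h3); have := normr_ge0 z.2; have := sz z.1; rewrite /B'.
  by move: h1; rewrite /GRing.scale/=; lra.
have := ler_normB (x.2 + s *: z.2) (s *: z.2); rewrite addrK => h3.
apply: (le_trans h3); have := normr_ge0 z.1; have := sz z.2; rewrite /B'.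
by move: h2; rewrite /GRing.scale/=; lra.
Qed.

Lemma tameM v h M : borel v -> (forall x, `|v x| <= M) -> tame h -> tame (fun x => v x * h x).
Proof.
move=> bv vM [bh [M' [B hMB]]]; split; first exact: measurable_funM.
exists (M * M'), B => x; rewrite normrM -mulrA; apply: ler_pM => //.
Qed.

Lemma Rintegral_shift h z : borel h ->
  \int[mu2]_x h (x + z) = \int[mu2]_x h x.
Proof.
move=> bh; rewrite /Rintegral; congr fine.
apply: (@integral_preserving _ _ _ _ _ mu2 mu2 (fun x => x + z) _ _ (EFin \o h)).
- exact: measurable_shift_plane.
- exact: plane_measure_shift.
- exact/measurable_EFinP.
Qed.

Lemma measurable_shear z : measurable_fun setT
  (fun p : plane R * line R => (p.1 + p.2 *: z : R * R) : plane R).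
Proof.
have m1 : measurable_fun setT (fun p : plane R * line R => p.1.1 : R).
  by apply: (measurableT_comp measurable_fst); exact: measurable_fst.
have m2 : measurable_fun setT (fun p : plane R * line R => p.1.2 : R).
  by apply: (measurableT_comp measurable_snd); exact: measurable_fst.
have m3 c : measurable_fun setT (fun p : plane R * line R => p.2 * c : R).
  by apply: measurable_funM; [exact: measurable_snd|exact: measurable_cst].
apply: (@measurable_fun_pair _ _ _ _ _ _ (fun p : plane R * line R => p.1.1 + p.2 * z.1 : line R)
  (fun p : plane R * line R => p.1.2 + p.2 * z.2 : line R)).
- exact: (measurable_funD m1 (m3 _)).
- exact: (measurable_funD m2 (m3 _)).
Qed.

Lemma borel_line v x z : borel v -> measurable_fun setT (fun s : line R => v (x + s *: z)).
Proof.
move=> bv; apply: (measurableT_comp bv).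
exact: (measurableT_comp (measurable_shear z) (measurable_pair1 x)).
Qed.

Lemma avg_le z a v x c : 0 < a -> borel v -> (exists M, forall y, `|v y| <= M) ->
  (forall y, v y <= c) -> avg z a v x <= c.
Proof.
move=> a0 bv [M vM] vc; rewrite /avg ler_pdivrMl// -(Rintegral_itv_cst c a0).
apply: le_Rintegral => //.
- by apply: (bounded_line_integrable (M := M)); [exact: borel_line|].
- by apply: (bounded_line_integrable (M := `|c|)); [exact: measurable_cst|].
Qed.

Lemma avg_ge z a v x c : 0 < a -> borel v -> (exists M, forall y, `|v y| <= M) ->
  (forall y, c <= v y) -> c <= avg z a v x.
Proof.
move=> a0 bv [M vM] vc; rewrite /avg ler_pdivlMl// -(Rintegral_itv_cst c a0).
apply: le_Rintegral => //.
- by apply: (bounded_line_integrable (M := `|c|)); [exact: measurable_cst|].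
- by apply: (bounded_line_integrable (M := M)); [exact: borel_line|].
Qed.

Lemma avg_fubini z a v h : 0 < a -> borel v -> (exists M, forall y, `|v y| <= M) ->
  tame h ->
  [/\ mu.-integrable `[0, a] (fun s => (\int[mu2]_x (v (x + s *: z) * h x))%:E) &
  \int[mu2]_x (avg z a v x * h x) =
  a^-1 * \int[mu]_(s in `[0, a]) (\int[mu2]_x (v (x + s *: z) * h x))].
Proof.
move=> a0 bv [M vM] th.
have [M' [B hMB]] := th.2.
have [] := @dominated_Rfubini _ (plane R) R mu2 (@borel_area_sigma_finite R)
    (fun x s => v (x + s *: z) * h x)
  (fun x => `|M| * (`|M'| * \1_[set y : R * R | `|y.1| <= B /\ `|y.2| <= B] x)) a.
- apply: measurable_funM.
    by apply: (measurableT_comp bv); exact: measurable_shear.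
  by apply: (measurableT_comp th.1); exact: measurable_fst.
- move=> x s _; rewrite normrM ler_pM//; first by rewrite (le_trans (vM _)) ?ler_norm.
  by rewrite (le_trans (hMB _)) ?ler_wpM2r ?ler_norm.
- rewrite (_ : (fun _ => _) = (fun x : R * R =>
    `|M| * `|M'| * \1_[set y : R * R | `|y.1| <= B /\ `|y.2| <= B] x)).
    exact: box_integrable.
  by apply/funext => x; rewrite mulrA.
move=> i1 i2 E; split => //; rewrite -E -RintegralZl//.
apply: eq_Rintegral => x _; rewrite /avg -mulrA; congr (_ * _).
rewrite -RintegralZr//.
by apply: (bounded_line_integrable (M := M)); [exact: borel_line|].
Qed.

Lemma borel_avg z a v : borel v -> (exists M, forall y, `|v y| <= M) ->
  borel (avg z a v).
Proof.
move=> bv [M vM].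
(* Fubini gives measurability for integrable integrands, so the integrand is cut off by growing
   squares in the base point [x]. At each [x] the resulting sequence is eventually constant. *)
pose h (n : nat) (x : R * R) : R := \1_[set y : R * R | `|y.1| <= n%:R /\ `|y.2| <= n%:R] x.
have bh n : borel (h n).
  have /measurable_EFinP := measurable_int _ (box_integrable 1 n%:R).
  by under eq_fun do rewrite mul1r.
have mG n : borel (fun x => \int[mu]_(s in `[0, a]) (v (x + s *: z) * h n x)).
  have [] := @dominated_Rfubini _ (plane R) R mu2 (@borel_area_sigma_finite R)
    (fun x s => v (x + s *: z) * h n x)
    (fun x => M * h n x) a.
  - apply: measurable_funM.
      by apply: (measurableT_comp bv); exact: measurable_shear.
    by apply: (measurableT_comp (bh n)); exact: measurable_fst.
  - by move=> x s _; rewrite normrM ler_pM// /h ger0_norm.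
  - exact: box_integrable.
  by move=> /(measurable_int mu2)/measurable_EFinP.
apply: measurable_funM; first exact: measurable_cst.
apply: (@measurable_fun_cvg _ _ _ _ _ _ mG) => x _.
apply: cvg_near_cst; near=> n.
have -> : h n x = 1.
  rewrite /h indicE mem_set//; split.
    by near: n; exact: nbhs_infty_ger.
  by near: n; exact: nbhs_infty_ger.
by apply: eq_Rintegral => s _; rewrite mulr1.
Unshelve. all: by end_near. Qed.

End averages.

(** * Sliding integrals of bounded functions of one variable *)

Section windows.
Context {R : realType} (k : R -> R) (M : R).
Hypotheses (mk : measurable_fun setT k) (kM : forall s, `|k s| <= M).
Local Notation mu := (@lebesgue_measure R).

Definition window a t : R := \int[mu]_(s in `[0, a]) k (t + s).

Lemma windowE a t : window a t = \int[mu]_(s in `[t, t + a]) k s.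
Proof.
rewrite /window Rintegral_mkcond [RHS]Rintegral_mkcond /Rintegral; congr fine.
pose psi := EFin \o (k \_ `[t, t + a]).
have mpsi : measurable_fun setT psi.
  apply/measurable_EFinP/(measurable_restrictT _ _).1; first exact: measurable_itv.
  exact: measurable_funTS.
rewrite -[RHS](@integral_preserving _ _ _ _ _ mu mu (fun x : line R => x + t : line R)
  (measurable_shift_line t) (lebesgue_measure_shift t) psi mpsi).
apply: eq_integral => s _; rewrite /psi/= !patchE addrC; congr EFin.
by rewrite !mem_setE !in_itv/= lerDr addrC lerD2l.
Qed.

Let F c t : R := \int[mu]_(s in `[c, t]) k s.

Lemma primitiveB c t t' : c <= t -> t <= t' -> F c t' - F c t = \int[mu]_(s in `[t, t']) k s.
Proof.
move=> ct tt'; rewrite /F (@Rintegral_itvB _ k (BLeft c) (BRight t') t)//.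
- apply: Rintegral_itv_obnd_cbnd.
  apply: (@integrableS _ _ _ mu `[t, t']%classic) => //; first exact: subset_itv_oc_cc.
  exact: (bounded_line_integrable (M := M)).
- exact: (bounded_line_integrable (M := M)).
Qed.

Lemma primitive_lipschitz c t t' : c <= t -> t <= t' -> `|F c t' - F c t| <= M * (t' - t).
Proof.
move=> ct; rewrite le_eqVlt => /predU1P[<-|tt']; first by rewrite !subrr normr0 mulr0.
have tt'w := ltW tt'; rewrite primitiveB//.
apply: (le_trans (le_normr_Rintegral _ _)); first exact: measurable_itv.
  exact: (bounded_line_integrable (M := M)).
have -> : M * (t' - t) = \int[mu]_(s in `[t, t']) M.
  rewrite Rintegral_cst; last exact: measurable_itv.
  have E : mu (`[t, t']%classic : set R) = (t' - t)%:E.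
    by rewrite lebesgue_measure_itv/= lte_fin tt' EFinB.
  by rewrite [fine _](congr1 fine E).
apply: le_Rintegral => //.
- apply: (bounded_line_integrable (M := M)); first exact: measurableT_comp.
  by move=> s; rewrite normr_id.
- by apply: (bounded_line_integrable (M := `|M|)); first exact: measurable_cst.
Qed.

Lemma window_primitive a c t : c <= t -> 0 <= a -> window a t = F c (t + a) - F c t.
Proof. by move=> ct a0; rewrite windowE primitiveB// lerDl. Qed.

(** Sliding the window changes the integral by one segment of length [|t' - t|] at each end, hence
    the factor 2. *)
Lemma window_lipschitz a t t' : 0 <= a -> `|window a t' - window a t| <= 2 * M * `|t' - t|.
Proof.
move=> a0; wlog tt' : t t' / t <= t'.
  move=> H; have [tt'|/ltW t't] := leP t t'; first exact: H.
  by rewrite distrC (distrC t'); exact: H.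
rewrite (@window_primitive a t t')// (@window_primitive a t t)//.
have h1 := primitive_lipschitz (lexx t) tt'.
have h2 : `|F t (t' + a) - F t (t + a)| <= M * (t' + a - (t + a)).
  by apply: primitive_lipschitz; rewrite ?lerDl ?lerD2r.
rewrite [`|t' - t|]ger0_norm ?subr_ge0//.
have -> : F t (t' + a) - F t t' - (F t (t + a) - F t t) =
  (F t (t' + a) - F t (t + a)) - (F t t' - F t t) by ring.
by apply: (le_trans (ler_normB _ _)); lra.
Qed.

Lemma window_is_derive (a t : R) : continuous k -> 0 <= a ->
  is_derive t (1 : R) (window a) (k (t + a) - k t).
Proof.
(* Any base point below [t] would do: the primitive from [c] represents the window at all points
   near [t] and is differentiable at [t] and at [t + a]. *)
move=> ck a0; pose c := t - 1.
have dF x : c < x -> is_derive x (1 : R) (F c) (k x).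
  move=> cx; have [] := @continuous_FTC1_closed _ k c x (x + 1) _ _ cx (ck x).
  - by rewrite ltrDl.
  - exact: (bounded_line_integrable (M := M)).
  by move=> dF; rewrite derive1E => <-; exact: DeriveDef.
have ct : c < t by rewrite /c; lra.
have dG : is_derive t (1 : R) (fun x => F c (x + a) - F c x) (k (t + a) - k t).
  apply: is_deriveB; last exact: dF.
  rewrite -[k (t + a)]mulr1.
  apply: (@is_derive1_comp _ (F c) (fun x => x + a)); first by apply: dF; lra.
  rewrite -[X in is_derive _ _ _ X]addr0.
  exact: is_deriveD.
apply: near_eq_is_derive dG.
near=> x; rewrite (@window_primitive _ c)//.
by apply: ltW; near: x; exact: lt_nbhsr.
Unshelve. all: by end_near. Qed.

Lemma window_cvg_ae (r : R) : 0 < r -> {ae mu, forall t,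
  (fun n => (r / n.+1%:R)^-1 * window (r / n.+1%:R) t) @ \oo --> k t}.
Proof.
move=> r0.
have lk : locally_integrable setT k.
  split => //; first exact: openT.
  move=> K _ cK; have mK := compact_measurable cK.
  have : mu.-integrable K (EFin \o k).
    apply: measurable_bounded_integrable => //; first exact: compact_finite_measure.
      exact: measurable_funTS.
    exists `|M|; split; first exact: num_real.
    by move=> x Mx s _ /=; rewrite (le_trans (kM s))// (le_trans (ler_norm M))// ltW.
  by move=> /integrableP[].
pose E (x : R) n : set R := `[x, x + r / n.+1%:R]%classic.
have rn n : 0 < r / n.+1%:R by rewrite divr_gt0.
have muE x n : mu (E x n) = (r / n.+1%:R)%:E.
  by rewrite /E lebesgue_measure_itv/= lte_fin ltrDl rn -EFinB addrAC subrr add0r.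
have nE x : nicely_shrinking x (E x).
  split; first by move=> n; exact: measurable_itv.
  have rho n : 0 < 2 * (r / n.+1%:R) by rewrite mulr_gt0.
  (* The open ball of radius twice the length of the segment contains the closed segment; its
     measure is four times that length, hence the ratio 4. *)
  exists (4, fun n => PosNum (rho n)); split => //=.
  - rewrite [X in _ --> X](_ : 0 = 2 * (r * 0)); last by rewrite !mulr0.
    by apply: cvgMr; apply: cvgMr; exact: cvg_harmonic.
  - move=> n s; rewrite /E /= in_itv/= => /andP[s1 s2].
    suff : `|x - s| < 2 * (r / n.+1%:R) by [].
    by move: (rn n) s1 s2; move: (r / _) => q *; rewrite ltr_norml; lra.
  - move=> n; rewrite muE lebesgue_measure_ball; last by rewrite ltW.
    by rewrite -EFinM lee_fin; move: (rn n); move: (r / _) => q *; lra.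
have := lebesgue_differentiation lk.
apply: filterS; first exact: (ae_filter_ringOfSetsType mu).
move=> t /(nice_lebesgue_differentiation nE lk)/fine_cvg; apply: cvg_trans.
apply: near_eq_cvg; near=> n; rewrite /= muE windowE /Rintegral /E.
have rn0 : r / n.+1%:R != 0 by rewrite gt_eqF.
rewrite inver (negbTE rn0).
rewrite fineM//.
by apply: integrable_fin_num; [exact: measurable_itv|exact: (bounded_line_integrable (M := M))].
Unshelve. all: by end_near. Qed.

End windows.

(** * Regularity and convergence of averages *)

Lemma Rdominated_cvg d (T : measurableType d) (R : realType)
    (m : {measure set T -> \bar R}) (D : set T) (f_ : nat -> T -> R) (f g : T -> R) :
  measurable D -> (forall n, measurable_fun D (f_ n)) -> measurable_fun D f ->
  {ae m, forall x, D x -> f_ ^~ x @ \oo --> f x} ->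
  m.-integrable D (EFin \o g) ->
  (forall n x, D x -> `|f_ n x| <= g x) ->
  (fun n => \int[m]_(x in D) f_ n x) @ \oo --> \int[m]_(x in D) f x.
Proof.
move=> mD mf_ mf f_f ig f_g.
have [] := @dominated_convergence _ T R m D mD (fun n => EFin \o f_ n) (EFin \o f) (EFin \o g).
- by move=> n; exact/measurable_EFinP.
- exact/measurable_EFinP.
- apply: filterS f_f => x f_f Dx; apply: cvg_EFin; last exact: f_f.
  exact: nearW.
- exact: ig.
- by apply: aeW => x n Dx; rewrite lee_fin f_g.
move=> iF _ c; apply: fine_cvg; rewrite fineK//.
exact: integrable_fin_num.
Qed.

Lemma is_derive_continuous {R : realType} (g dg : R -> R) :
  (forall t, is_derive t (1 : R) g (dg t)) -> continuous g.
Proof.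
by move=> d t; apply/differentiable_continuous/derivable1_diffP; have [] := d t.
Qed.

Section directional.
Context {R : realType}.
Implicit Types (x z : R * R) (f : R * R -> R).

(** The two difference quotients are the same function of the increment, so directional derivatives
    inherit the calculus of one variable. *)
Lemma is_derive_line f x z (s d : R) :
  is_derive (x + s *: z) z f d <-> is_derive s (1 : R) (fun t : R => f (x + t *: z)) d.
Proof.
have E : (fun h : R => h^-1 *: (f (h *: z + (x + s *: z)) - f (x + s *: z))) =
    (fun h : R => h^-1 *: (f (x + (h *: 1 + s) *: z) - f (x + s *: z))).
  apply/funext => h; rewrite scalerDl addrCA; congr (_ *: (f (_ + (_ *: _ + _)) - _)).
  exact/esym/mulr1.
split=> -[D1 D2]; split.
- by rewrite /derivable /= -E.
- by rewrite /derive /= -E.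
- by rewrite /derivable /= E.
- by rewrite /derive /= E.
Qed.

Lemma is_derive_line0 f x z (d : R) :
  is_derive x z f d <-> is_derive (0 : R) (1 : R) (fun t : R => f (x + t *: z)) d.
Proof. by rewrite -is_derive_line scale0r addr0. Qed.

Lemma lipschitz_e1_e2_continuous f (L : R) :
  (forall x t, `|f (x + t *: e1 R) - f x| <= L * `|t|) ->
  (forall x t, `|f (x + t *: e2 R) - f x| <= L * `|t|) -> continuous f.
Proof.
move=> L1 L2 x.
have L0 : 0 <= L by have := le_trans (normr_ge0 _) (L1 x 1); rewrite normr1 mulr1.
have E (y : R * R) : y = (x + (y.1 - x.1) *: e1 R) + (y.2 - x.2) *: e2 R.
  by rewrite /e1 /e2; case: x y => [? ?] [? ?]; congr pair => /=; rewrite /GRing.scale/=; ring.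
apply/cvgrPdist_le => e e0.
(* [L + 1] rather than [L], which may be zero. *)
have e0' : 0 < e / (2 * (L + 1)) by rewrite divr_gt0// mulr_gt0//; lra.
have nb : nbhs x (ball x (e / (2 * (L + 1)))) by exact: nbhsx_ballx.
near=> y; have -> : f y = f ((x + (y.1 - x.1) *: e1 R) + (y.2 - x.2) *: e2 R) by rewrite -E.
set y' := x + _; rewrite distrC.
have -> : f (y' + (y.2 - x.2) *: e2 R) - f x =
  (f (y' + (y.2 - x.2) *: e2 R) - f y') + (f y' - f x) by ring.
apply: (le_trans (ler_normD _ _)).
have h1 := L1 x (y.1 - x.1); have h2 := L2 y' (y.2 - x.2).
have [b1 b2] : `|y.1 - x.1| <= e / (2 * (L + 1)) /\ `|y.2 - x.2| <= e / (2 * (L + 1)).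
  suff : ball x (e / (2 * (L + 1))) y by case; rewrite /ball/= !(distrC _ y.1, distrC _ y.2) => /ltW ? /ltW.
  by near: y; exact: nb.
have K : L * (e / (2 * (L + 1))) <= e / 2.
  rewrite mulrA ler_pdivrMr; last by rewrite mulr_gt0//; lra.
  by rewrite (_ : e / 2 * (2 * (L + 1)) = L * e + e); [rewrite lerDl ltW|field].
have K1 : L * `|y.1 - x.1| <= e / 2 by apply: le_trans K; exact: ler_wpM2l.
have K2 : L * `|y.2 - x.2| <= e / 2 by apply: le_trans K; exact: ler_wpM2l.
by rewrite /y'; lra.
Unshelve. all: by end_near. Qed.

End directional.

Section averages_regularity.
Context {R : realType}.
Implicit Types (a : R) (z x : R * R) (v h : R * R -> R).
Local Notation mu := (@lebesgue_measure R).
Local Notation mu2 := (borel_area R).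

Lemma avg_window z a v x t :
  avg z a v (x + t *: z) = a^-1 * window (fun s => v (x + s *: z)) a t.
Proof.
by congr (_ * _); apply: eq_Rintegral => s _; rewrite scalerDl addrA.
Qed.

Lemma avg_lipschitz z a v M x t : 0 < a -> borel v -> (forall y, `|v y| <= M) ->
  `|avg z a v (x + t *: z) - avg z a v x| <= 2 * M / a * `|t|.
Proof.
move=> a0 bv vM; 
have -> : avg z a v x = avg z a v (x + 0 *: z) by rewrite scale0r addr0.
rewrite !avg_window -mulrBr normrM gtr0_norm ?invr_gt0// ler_pdivrMl//.
have := @window_lipschitz R (fun s => v (x + s *: z)) M
  (borel_line x z bv) (fun s => vM _) a 0 t (ltW a0).
by move=> /le_trans; apply; rewrite subr0 (_ : a * _ = 2 * M * `|t|)//; field; rewrite gt_eqF.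
Qed.

Lemma avg_keeps_lipschitz z z' a v M L : 0 < a -> borel v -> (forall y, `|v y| <= M) ->
  (forall x t, `|v (x + t *: z') - v x| <= L * `|t|) ->
  forall x t, `|avg z a v (x + t *: z') - avg z a v x| <= L * `|t|.
Proof.
move=> a0 bv vM vL x t.
have i1 y : mu.-integrable `[0, a] (EFin \o (fun s => v (y + s *: z))).
  by apply: (bounded_line_integrable (M := M)) => //; exact: borel_line.
rewrite /avg -mulrBr normrM gtr0_norm ?invr_gt0// ler_pdivrMl// -RintegralB//.
apply: (le_trans (le_normr_Rintegral _ _)) => //.
  by apply: (integrableB _ (i1 _) (i1 _)).
rewrite -(Rintegral_itv_cst _ a0); apply: le_Rintegral => //.
- apply: (bounded_line_integrable (M := M + M)).
    apply: measurableT_comp => //; apply: measurable_funB; exact: borel_line.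
  by move=> s; rewrite normr_id (le_trans (ler_normB _ _))// lerD.
- by apply: (bounded_line_integrable (M := `|L * `|t| |)); first exact: measurable_cst.
- by move=> s _; rewrite addrAC; exact: vL.
Qed.

Lemma avg_is_derive z a v M x : 0 < a -> continuous v -> (forall y, `|v y| <= M) ->
  is_derive x z (avg z a v) (a^-1 * (v (x + a *: z) - v x)).
Proof.
move=> a0 cv vM; apply/is_derive_line0.
under eq_fun do rewrite avg_window.
have bv : borel v by exact: continuous_measurable_plane.
have ck : continuous (fun s : R => v (x + s *: z)).
  move=> s; apply: continuous_comp; last exact: cv.
  by apply: cvgD; [exact: cvg_cst|apply: cvgZl; exact: cvg_id].
have := @window_is_derive R (fun s => v (x + s *: z)) M
  (borel_line x z bv) (fun s => vM _) a 0 ck (ltW a0).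
rewrite add0r scale0r addr0 => dw.
exact: is_deriveZ.
Qed.

(** Fubini on a rectangle. The segment in direction [z] is encoded by its indicator because
    [dominated_Rfubini] takes one of its two integrals over a whole space. *)
Lemma avgC z z' a a' v M x : borel v -> (forall y, `|v y| <= M) ->
  avg z a (avg z' a' v) x = avg z' a' (avg z a v) x.
Proof.
move=> bv vM; rewrite /avg.
pose I : set (line R) := `[0, a]%classic.
have mI : measurable I by exact: measurable_itv.
have := @dominated_Rfubini _ (line R) R mu (sigma_finiteT _)
  (fun s s' => \1_I s * v (x + s *: z + s' *: z')) (fun s => M * \1_I s) a'.
have mv : measurable_fun setT (fun p : line R * line R => v (x + p.1 *: z + p.2 *: z')).
  apply: (measurableT_comp bv).
  apply: (@measurable_fun_pair _ _ _ _ _ _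
     (fun p : line R * line R => x.1 + p.1 * z.1 + p.2 * z'.1 : line R)
     (fun p : line R * line R => x.2 + p.1 * z.2 + p.2 * z'.2 : line R)).
  - apply: measurable_funD; last by apply: measurable_funM; [exact: measurable_snd|exact: measurable_cst].
    apply: measurable_funD; first exact: measurable_cst.
    by apply: measurable_funM; [exact: measurable_fst|exact: measurable_cst].
  - apply: measurable_funD; last by apply: measurable_funM; [exact: measurable_snd|exact: measurable_cst].
    apply: measurable_funD; first exact: measurable_cst.
    by apply: measurable_funM; [exact: measurable_fst|exact: measurable_cst].
have mI1 : measurable_fun setT (fun p : line R * line R => \1_I p.1 : R).
  by apply: measurableT_comp; [exact: measurable_indic|exact: measurable_fst].
case.
- exact: (measurable_funM mI1 mv).
- move=> s s' _; rewrite normrM mulrC [X in _ * X]ger0_norm ?indicE//.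
  by apply: ler_wpM2r.
- have : mu.-integrable I (EFin \o cst M).
    by apply: (bounded_line_integrable (M := `|M|)) => //.
  move/(integrable_mkcond _ mI); apply: eq_integrable => // s _.
  by rewrite patchE /= indicE; case: ifPn => _; rewrite ?mulr1 ?mulr0.
move=> i1 i2 E.
have E1 : \int[mu]_(s in `[0, a]) (a'^-1 * \int[mu]_(s' in `[0, a']) v (x + s *: z + s' *: z')) =
  \int[mu]_s (a'^-1 * \int[mu]_(s' in `[0, a']) (\1_I s * v (x + s *: z + s' *: z'))).
  rewrite Rintegral_mkcond; apply: eq_Rintegral => s _.
  rewrite patchE indicE -/I; case: ifPn => _.
    by congr (_ * _); apply: eq_Rintegral => s' _; rewrite mul1r.
  under eq_Rintegral do rewrite mul0r.
  by rewrite Rintegral_cst ?mul0r ?mulr0//; exact: measurable_itv.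
have E2 : \int[mu]_(s' in `[0, a']) (a^-1 * \int[mu]_(s in `[0, a]) v (x + s' *: z' + s *: z)) =
  \int[mu]_(s' in `[0, a']) (a^-1 * \int[mu]_s (\1_I s * v (x + s *: z + s' *: z'))).
  apply: eq_Rintegral => s' _; congr (_ * _).
  rewrite [LHS]Rintegral_mkcond; apply: eq_Rintegral => s _.
  rewrite patchE indicE -/I; case: ifPn => _; last by rewrite mul0r.
  by rewrite mul1r addrAC.
rewrite [X in _ * X = _]E1 [X in _ = _ * X]E2.
rewrite (RintegralZl _ measurableT i1) (RintegralZl _ _ i2); last exact: measurable_itv.
by rewrite E mulrCA.
Qed.

(** By Fubini the integral is a mean over the shifts [s *: z] of [v]; translation invariance moves
    each shift from [v], which has no regularity, to the weight [h]. *)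
Lemma avg_int_le z a v h M T : 0 < a -> borel v -> (forall y, `|v y| <= M) -> tame h ->
  (forall s, 0 <= s <= a -> \int[mu2]_x (v x * h (x - s *: z)) <= T) ->
  \int[mu2]_x (avg z a v x * h x) <= T.
Proof.
move=> a0 bv vM th hT.
have [i ->] := avg_fubini z a0 bv (ex_intro _ M vM) th.
rewrite ler_pdivrMl// -(Rintegral_itv_cst _ a0); apply: le_Rintegral => //.
  by apply: (bounded_line_integrable (M := `|T|)); first exact: measurable_cst.
move=> s; rewrite /= in_itv/= => sa; apply: le_trans (hT s sa).
rewrite -[leLHS](@Rintegral_shift _ _ (- (s *: z))).
  by under eq_Rintegral do rewrite subrK.
apply: measurable_funM; last exact: th.1.
by apply: (measurableT_comp bv); exact: measurable_shift_plane.
Qed.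

End averages_regularity.

Section averages_convergence.
Context {R : realType}.
Implicit Types (z x : R * R) (v h : R * R -> R).
Local Notation mu := (@lebesgue_measure R).
Local Notation mu2 := (borel_area R).

(* The integrals are unchanged when the integrand is translated by s *: z.  Averaging
   over 0 <= s <= 1 leaves only convergence almost everywhere on each line in the
   direction z to be checked, which is Lebesgue's differentiation theorem. *)
Lemma avg_L1_cvg z (r : R) v h M : 0 < r -> borel v -> (forall y, `|v y| <= M) -> tame h ->
  (fun n => \int[mu2]_x (`|avg z (r / n.+1%:R) v x - v x| * h x)) @ \oo --> 0.
Proof.
move=> r0 bv vM th.
have rn n : 0 < r / n.+1%:R by rewrite divr_gt0.
pose D n x := `|avg z (r / n.+1%:R) v x - v x|.
have M0 : 0 <= M by exact: le_trans (normr_ge0 _) (vM 0).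
have avgM n x : `|avg z (r / n.+1%:R) v x| <= M.
  rewrite ler_norml avg_ge ?avg_le//.
  - by exists M.
  - by move=> y; exact: le_trans (ler_norm _) (vM y).
  - by exists M.
  - by move=> y; have := vM y; rewrite ler_norml => /andP[].
have DM n x : `|D n x| <= 2 * M.
  by rewrite /D normr_id (le_trans (ler_normB _ _))//; have := avgM n x; have := vM x; lra.
have bD n : borel (D n).
  apply: measurableT_comp => //; apply: measurable_funB => //.
  by apply: borel_avg => //; exists M.
have [H0 iH0 hH0] := tame_dominated z th.
pose H x := 2 * M * H0 x.
have iH : mu2.-integrable setT (EFin \o H).
  by apply: (integrableZl measurableT (2 * M) iH0).
pose G n x s := D n (x + s *: z) * h (x + s *: z).
have GH n x s : 0 <= s <= 1 -> `|G n x s| <= H x.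
  by move=> s01; rewrite /G normrM ler_pM// hH0.
have mG n : measurable_fun setT (fun p : plane R * line R => G n p.1 p.2).
  apply: measurable_funM.
    by apply: (measurableT_comp (bD n)); exact: measurable_shear.
  by apply: (measurableT_comp th.1); exact: measurable_shear.
have J n : \int[mu2]_x (D n x * h x) = \int[mu2]_x (\int[mu]_(s in `[0, 1]) G n x s).
  have [_ _ ->] := @dominated_Rfubini _ (plane R) R mu2 (@borel_area_sigma_finite R)
    (G n) H 1 (mG n) (GH n) iH.
  rewrite -[LHS]mul1r -(Rintegral_itv_cst _ (@ltr01 R)).
  apply: eq_Rintegral => s _; apply/esym; rewrite /G.
  apply: (@Rintegral_shift _ (fun x => D n x * h x)).
  exact: (measurable_funM (bD n) th.1).
have mGx n x : measurable_fun setT (G n x).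
  exact: (measurableT_comp (mG n) (measurable_pair1 x)).
rewrite (_ : (fun n => _) = fun n => \int[mu2]_x (\int[mu]_(s in `[0, 1]) G n x s)); last first.
  by apply/funext => n; exact: J.
have E0 : \int[mu2]_(x in setT) (0 : R) = 0 by rewrite /Rintegral integral0_eq.
rewrite -[X in _ --> X]E0.
apply: (@Rdominated_cvg _ _ _ mu2 setT _ (cst 0) H) => //.
- move=> n; have [+ _ _] := @dominated_Rfubini _ (plane R) R mu2 (@borel_area_sigma_finite R)
    (G n) H 1 (mG n) (GH n) iH.
  by move=> /(measurable_int mu2)/measurable_EFinP.
- apply: aeW => x _ /=.
  have E1 : \int[mu]_(s in `[0, 1]) (0 : R) = 0 by rewrite Rintegral_itv_cst// mulr0.
  rewrite -[X in _ --> X]E1.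
  apply: (@Rdominated_cvg _ _ _ mu `[0, 1]%classic _ (cst 0) (fun=> H x)) => //.
  + by move=> n; apply: measurable_funTS; exact: mGx.
  + have := @window_cvg_ae R (fun s => v (x + s *: z)) M (borel_line x z bv) (fun s => vM _) r r0.
    apply: filterS; first exact: (ae_filter_ringOfSetsType mu).
    move=> s cs _; rewrite /G /D /cst /=.
    under eq_fun do rewrite avg_window.
    have c1 := cvg_norm (cvgB cs (cvg_cst (v (x + s *: z)))).
    rewrite subrr normr0 in c1.
    rewrite -[X in nbhs X](mul0r (h (x + s *: z))).
    by apply: (@cvgM R _ \oo); [exact: c1|exact: cvg_cst].
  + apply: (bounded_line_integrable (M := `|H x|)) => //.
  + by move=> n s; rewrite /= in_itv/= => s01; exact: GH.
- move=> n x _; apply: (le_trans (le_normr_Rintegral _ _)) => //.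
    apply: (@le_integrable _ _ _ mu _ _ _ (cst (H x)%:E)) => //.
    + by apply/measurable_EFinP; apply: measurable_funTS; exact: mGx.
    + move=> s; rewrite /= in_itv/= => s01; rewrite lee_fin.
      by apply: (le_trans (GH _ _ _ s01)); rewrite ler_norm.
    + exact: (bounded_line_integrable (k := cst (H x)) (M := `|H x|)).
  rewrite -[leRHS]mul1r -(Rintegral_itv_cst _ (@ltr01 R)); apply: le_Rintegral => //.
  + apply: (@le_integrable _ _ _ mu _ _ _ (cst (H x)%:E)) => //.
    * apply/measurable_EFinP; apply: measurable_funTS; apply: measurableT_comp => //; exact: mGx.
    * move=> s; rewrite /= in_itv/= => s01; rewrite lee_fin normr_id.
      by apply: (le_trans (GH _ _ _ s01)); rewrite ler_norm.
    * exact: (bounded_line_integrable (k := cst (H x)) (M := `|H x|)).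
  + exact: (bounded_line_integrable (k := cst (H x)) (M := `|H x|)).
  + by move=> s; rewrite /= in_itv/= => s01; exact: GH.
Qed.

(** The Lipschitz bound on [k] reduces the claim to [avg_L1_cvg] with weight [|h|]. It is asked on
    [0, 1] only, where [v] and its averages take their values. *)
Lemma avg_comp_cvg z (r : R) v h (k : R -> R) : 0 < r -> borel v ->
  (forall y, 0 <= v y <= 1) -> tame h -> measurable_fun setT k ->
  (forall s t, 0 <= s <= 1 -> 0 <= t <= 1 -> `|k s - k t| <= `|s - t|) ->
  (fun n => \int[mu2]_x (k (avg z (r / n.+1%:R) v x) * h x)) @ \oo -->
  \int[mu2]_x (k (v x) * h x).
Proof.
move=> r0 bv v01 th mk kL.
have rn n : 0 < r / n.+1%:R by rewrite divr_gt0.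
have v1 y : `|v y| <= 1 by have := v01 y; rewrite ler_norml; lra.
have a01 n x : 0 <= avg z (r / n.+1%:R) v x <= 1.
  apply/andP; split; [apply: avg_ge => //|apply: avg_le => //].
  - by exists 1.
  - by move=> y; case/andP: (v01 y).
  - by exists 1.
  - by move=> y; case/andP: (v01 y).
have kb s : 0 <= s <= 1 -> `|k s| <= `|k 0| + 1.
  move=> s01; have := kL s 0 s01 ltac:(rewrite lexx ler01//); rewrite subr0.
  have := ler_normD (k s - k 0) (k 0); rewrite subrK => h1 h2.
  by rewrite (le_trans h1)// addrC lerD2l (le_trans h2)// ger0_norm; case/andP: s01.
have tk w : borel w -> (forall x, 0 <= w x <= 1) -> tame (fun x => k (w x) * h x).
  move=> bw w01; apply: (@tameM _ _ _ (`|k 0| + 1)) => //.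
    exact: measurableT_comp.
  by move=> x; exact: kb.
have bA n : borel (avg z (r / n.+1%:R) v) by apply: borel_avg => //; exists 1.
have thn : tame (fun x => `|h x|).
  split; first by apply: measurableT_comp => //; exact: th.1.
  by have [M' [B hMB]] := th.2; exists M', B => x; rewrite normr_id.
have cJ := avg_L1_cvg z r0 bv v1 thn.
apply/cvgrPdist_le => e e0.
move/cvgrPdist_le/(_ e e0) : cJ; apply: filterS => n; rewrite sub0r normrN => /(le_trans _); apply.
have ik := tame_integrable (tk _ bv v01); have ikn := tame_integrable (tk _ (bA n) (a01 n)).
rewrite -RintegralB//.
apply: (le_trans (le_normr_Rintegral _ _)) => //.
  exact: (integrableB measurableT ik ikn).
apply: le_trans (ler_norm _); apply: le_Rintegral => //.
- apply: integrable_norm.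
  exact: (integrableB measurableT ik ikn).
- apply: tame_integrable; apply: (@tameM _ _ _ 2) => //.
    apply: measurableT_comp => //; apply: measurable_funB => //; exact: bA.
  move=> x; rewrite normr_id; have := a01 n x; have := v01 x; rewrite ler_norml; lra.
- by move=> x _; rewrite -mulrBl normrM ler_wpM2r// distrC kL.
Qed.

End averages_convergence.

(** * Continuously differentiable functions and test fields *)

Section calculus.
Context {R : realType}.
Implicit Types (x z : R * R) (f p q w F : R * R -> R) (K : set (R * R)).
Local Notation mu := (@lebesgue_measure R).
Local Notation mu2 := (borel_area R).

Lemma is_derive_comp1 (k : R -> R) w x z (dk dw : R) :
  is_derive (w x) (1 : R) k dk -> is_derive x z w dw ->
  is_derive x z (k \o w) (dk * dw).
Proof.
move=> hk /is_derive_line0 hw; apply/is_derive_line0.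
by apply: (@is_derive1_comp _ k (fun t => w (x + t *: z))) => //; rewrite scale0r addr0.
Qed.

Lemma compact_box K : compact K -> exists B : R, forall x, K x -> `|x.1| <= B /\ `|x.2| <= B.
Proof.
move=> /compact_bounded [B [_ hB]]; exists (B + 1) => x Kx.
have := hB (B + 1) ltac:(by rewrite ltrDl) x Kx.
by rewrite /= /Num.norm/= ge_max => /andP[].
Qed.

Lemma compact_support_tame f K : continuous f -> compact K ->
  (forall x, ~ K x -> f x = 0) -> tame f.
Proof.
move=> cf cK fK; split; first exact: continuous_measurable_plane.
have [B hB] := compact_box cK.
have /compact_bounded [M [_ hM]] : compact (f @` K).
  by apply: continuous_compact => //; exact: continuous_subspaceT.
exists (`|M| + 1), B => x; rewrite indicE.
have [Kx|nKx] := pselect (K x).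
  rewrite mem_set ?mulr1; last exact: hB.
  apply: (hM (`|M| + 1)); last by exists x.
  by rewrite (le_lt_trans (ler_norm M))// ltrDl.
by rewrite fK// normr0 mulr_ge0// addr_ge0.
Qed.

(** By translation invariance the integral of [d] equals that of its mean over the shifts [s *: z]
    with 0 <= s <= 1. This mean is [F (x + z) - F x], whose integral vanishes, again by
    translation. *)
Lemma Rintegral_derive0 F (d : R * R -> R) z K : continuous d -> compact K ->
  (forall x, is_derive x z F (d x)) -> continuous F ->
  (forall x, ~ K x -> F x = 0) -> (forall x, ~ K x -> d x = 0) ->
  \int[mu2]_x d x = 0.
Proof.
move=> cd cK dF cF FK dK.
have td : tame d by exact: (compact_support_tame cd cK dK).
have tF : tame F by exact: (compact_support_tame cF cK FK).
have [H iH hH] := tame_dominated z td.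
have mG : measurable_fun setT (fun p : plane R * line R => d (p.1 + p.2 *: z)).
  by apply: (measurableT_comp td.1); exact: measurable_shear.
have [_ _ E] := @dominated_Rfubini _ (plane R) R mu2 (@borel_area_sigma_finite R)
  (fun x s => d (x + s *: z)) H 1 mG hH iH.
transitivity (\int[mu]_(s in `[0, 1]) \int[mu2]_x d (x + s *: z)).
  rewrite -[LHS]mul1r -(Rintegral_itv_cst _ (@ltr01 R)).
  by apply: eq_Rintegral => s _; rewrite Rintegral_shift//; exact: td.1.
rewrite -E; under eq_Rintegral => x _.
  have -> : \int[mu]_(s in `[0, 1]) d (x + s *: z) = F (x + z) - F x.
    have ck (k : R * R -> R) : continuous k -> continuous (fun s : R => k (x + s *: z)).
      move=> ck s; apply: continuous_comp; last exact: ck.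
      by apply: cvgD; [exact: cvg_cst|apply: cvgZl; exact: cvg_id].
    have dk s : is_derive s (1 : R) (fun t : R => F (x + t *: z)) (d (x + s *: z)).
      exact/is_derive_line.
    rewrite /Rintegral (@continuous_FTC2 _ _ (fun s => F (x + s *: z))) //=.
    - by rewrite scale1r scale0r addr0.
    - exact: continuous_subspaceT (ck _ cd).
    - split; first by move=> s _; have [] := dk s.
      + by apply: cvg_at_right_filter; exact: (ck _ cF).
      + by apply: cvg_at_left_filter; exact: (ck _ cF).
    - by move=> s _; rewrite derive1E; have [_ ->] := dk s.
  over.
rewrite RintegralB//; [|exact: tame_integrable (tame_shift z tF)|exact: tame_integrable].
by rewrite Rintegral_shift ?subrr//; exact: tF.1.
Qed.

Definition C1 f := [/\ continuous f, forall x, derivable f x (e1 R), forall x, derivable f x (e2 R),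
  continuous (fun x => 'D_(e1 R) f x) & continuous (fun x => 'D_(e2 R) f x)].

(** The mean value theorem along each axis gives Lipschitz bounds in both coordinate directions. *)
Lemma C1_lipschitz f L : (forall x, derivable f x (e1 R)) -> (forall x, derivable f x (e2 R)) ->
  (forall x, `|'D_(e1 R) f x| <= L) -> (forall x, `|'D_(e2 R) f x| <= L) ->
  continuous f.
Proof.
move=> d1 d2 L1 L2.
have aux z : (forall x, derivable f x z) -> (forall x, `|'D_z f x| <= L) ->
    forall x t, `|f (x + t *: z) - f x| <= L * `|t|.
  move=> d L3 x.
  have dk s : is_derive s (1 : R) (fun t : R => f (x + t *: z)) ('D_z f (x + s *: z)).
    by apply/is_derive_line; apply: DeriveDef.
  have ck : continuous (fun t : R => f (x + t *: z)).
    exact: is_derive_continuous dk.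
  have H (a b : R) : a <= b -> `|f (x + b *: z) - f (x + a *: z)| <= L * (b - a).
    move=> ab; have [c _ ->] := @MVT_segment R _ _ a b ab (fun s _ => dk s) (continuous_subspaceT ck).
    by rewrite normrM [X in _ * X]ger0_norm ?subr_ge0// ler_wpM2r// subr_ge0.
  move=> t; rewrite -[X in _ - f X]addr0 -(scale0r z).
  have [t0|/ltW t0] := leP 0 t.
    by apply: (le_trans (H 0 t t0)); rewrite subr0 ger0_norm.
  by rewrite distrC; apply: (le_trans (H t 0 t0)); rewrite sub0r ler0_norm.
exact: (lipschitz_e1_e2_continuous (aux _ d1 L1) (aux _ d2 L2)).
Qed.

Lemma C1_comp (k k' : R -> R) w : C1 w -> continuous k' ->
  (forall t, is_derive t (1 : R) k (k' t)) -> C1 (k \o w).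
Proof.
move=> [cw d1 d2 c1 c2] ck' dk.
have ck : continuous k.
  exact: is_derive_continuous dk.
have D z x : derivable w x z -> is_derive x z (k \o w) (k' (w x) * 'D_z w x).
  by move=> dw; exact: (is_derive_comp1 (dk _) (DeriveDef dw erefl)).
split.
- by move=> x; apply: continuous_comp; [exact: cw|exact: ck].
- by move=> x; have [] := D _ _ (d1 x).
- by move=> x; have [] := D _ _ (d2 x).
- rewrite (_ : (fun x => _) = fun x => k' (w x) * 'D_(e1 R) w x); last first.
    by apply/funext => x; have [_ ->] := D _ _ (d1 x).
  by move=> x; apply: cvgM; [apply: continuous_comp; [exact: cw|exact: ck']|exact: c1].
- rewrite (_ : (fun x => _) = fun x => k' (w x) * 'D_(e2 R) w x); last first.
    by apply/funext => x; have [_ ->] := D _ _ (d2 x).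
  by move=> x; apply: cvgM; [apply: continuous_comp; [exact: cw|exact: ck']|exact: c2].
Qed.

Lemma C1D p q : C1 p -> C1 q -> C1 (p + q).
Proof.
move=> [cp p1 p2 c1 c2] [cq q1 q2 c3 c4]; split.
- by move=> x; apply: cvgD; [exact: cp|exact: cq].
- by move=> x; apply: derivableD.
- by move=> x; apply: derivableD.
- rewrite (_ : (fun x => _) = fun x => 'D_(e1 R) p x + 'D_(e1 R) q x); last first.
    by apply/funext => x; rewrite deriveD.
  by move=> x; apply: cvgD; [exact: c1|exact: c3].
- rewrite (_ : (fun x => _) = fun x => 'D_(e2 R) p x + 'D_(e2 R) q x); last first.
    by apply/funext => x; rewrite deriveD.
  by move=> x; apply: cvgD; [exact: c2|exact: c4].
Qed.

Lemma C1M p q : C1 p -> C1 q -> C1 (p * q).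
Proof.
move=> [cp p1 p2 c1 c2] [cq q1 q2 c3 c4]; split.
- by move=> x; apply: cvgM; [exact: cp|exact: cq].
- by move=> x; apply: derivableM.
- by move=> x; apply: derivableM.
- rewrite (_ : (fun x => _) = fun x => p x * 'D_(e1 R) q x + q x * 'D_(e1 R) p x); last first.
    by apply/funext => x; rewrite deriveM.
  move=> x; apply: cvgD; apply: cvgM; [exact: cp|exact: c3|exact: cq|exact: c1].
- rewrite (_ : (fun x => _) = fun x => p x * 'D_(e2 R) q x + q x * 'D_(e2 R) p x); last first.
    by apply/funext => x; rewrite deriveM.
  move=> x; apply: cvgD; apply: cvgM; [exact: cp|exact: c4|exact: cq|exact: c2].
Qed.

Lemma C1N p : C1 p -> C1 (- p).
Proof.
move=> [cp p1 p2 c1 c2]; split.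
- by move=> x; apply: cvgN; exact: cp.
- by move=> x; apply: derivableN.
- by move=> x; apply: derivableN.
- rewrite (_ : (fun x => _) = fun x => - 'D_(e1 R) p x); last first.
    by apply/funext => x; rewrite deriveN.
  by move=> x; apply: cvgN; exact: c1.
- rewrite (_ : (fun x => _) = fun x => - 'D_(e2 R) p x); last first.
    by apply/funext => x; rewrite deriveN.
  by move=> x; apply: cvgN; exact: c2.
Qed.

Lemma derive_outside (V : normedModType R) (phi : R * R -> V) K x z :
  closed K -> (forall x, ~ K x -> phi x = 0) ->
  ~ K x -> 'D_z phi x = 0.
Proof.
move=> cK pK nKx; rewrite -(derive_cst (0 : V) x z).
apply: near_eq_derive; have : open (~` K) by exact: closed_openC.
rewrite openE => /(_ x nKx); apply: filterS => y; exact: pK.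
Qed.

End calculus.

Section fields.
Context {R : realType}.
Implicit Types (phi psi : R * R -> R * R) (x z : R * R) (K Omega : set (R * R)).

Lemma is_derive_fst phi x z : derivable phi x z -> is_derive x z (fst \o phi) ('D_z phi x).1.
Proof.
move=> d.
have c : (fun h : R => h^-1 *: ((fst \o phi) (h *: z + x) - (fst \o phi) x))
    @ (0 : R)^' --> ('D_z phi x).1.
  apply: (@cvg_comp _ _ _ (fun h : R => h^-1 *: (phi (h *: z + x) - phi x)) fst _ (nbhs ('D_z phi x))).
    exact: d.
  exact: cvg_fst.
by apply: DeriveDef; [apply/cvg_ex; eexists; exact: c|exact/cvg_lim].
Qed.

Lemma is_derive_snd phi x z : derivable phi x z -> is_derive x z (snd \o phi) ('D_z phi x).2.
Proof.
move=> d.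
have c : (fun h : R => h^-1 *: ((snd \o phi) (h *: z + x) - (snd \o phi) x))
    @ (0 : R)^' --> ('D_z phi x).2.
  apply: (@cvg_comp _ _ _ (fun h : R => h^-1 *: (phi (h *: z + x) - phi x)) snd _ (nbhs ('D_z phi x))).
    exact: d.
  exact: cvg_snd.
by apply: DeriveDef; [apply/cvg_ex; eexists; exact: c|exact/cvg_lim].
Qed.

Lemma is_derive_pair (p q : R * R -> R) x z (a b : R) : is_derive x z p a -> is_derive x z q b ->
  is_derive x z (fun y => (p y, q y) : R * R) (a, b).
Proof.
move=> [dp pE] [dq qE].
have c : (fun h : R => h^-1 *: (((p (h *: z + x), q (h *: z + x)) : R * R) - (p x, q x)))
    @ (0 : R)^' --> ((a, b) : R * R).
  rewrite -pE -qE; exact: (cvg_pair dp dq).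
by apply: DeriveDef; [apply/cvg_ex; eexists; exact: c|exact/cvg_lim].
Qed.

Lemma C1_field_pair (p q : R * R -> R) : C1 p -> C1 q -> C1_field (fun x => (p x, q x)).
Proof.
move=> [_ p1 p2 c1 c2] [_ q1 q2 c3 c4].
have D1 x := is_derive_pair (DeriveDef (p1 x) erefl) (DeriveDef (q1 x) erefl).
have D2 x := is_derive_pair (DeriveDef (p2 x) erefl) (DeriveDef (q2 x) erefl).
split.
- by move=> x; have [] := D1 x.
- by move=> x; have [] := D2 x.
- rewrite (_ : (fun x => 'D_(e1 R) (fun x => (p x, q x) : R * R) x) =
    fun x => ('D_(e1 R) p x, 'D_(e1 R) q x)); last first.
    by apply/funext => x; have [_ ->] := D1 x.
  by move=> x; exact: (cvg_pair (c1 x) (c3 x)).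
- rewrite (_ : (fun x => 'D_(e2 R) (fun x => (p x, q x) : R * R) x) =
    fun x => ('D_(e2 R) p x, 'D_(e2 R) q x)); last first.
    by apply/funext => x; have [_ ->] := D2 x.
  by move=> x; exact: (cvg_pair (c2 x) (c4 x)).
Qed.

Lemma divergence_pair (p q : R * R -> R) x : C1 p -> C1 q ->
  divergence (fun x => (p x, q x)) x = 'D_(e1 R) p x + 'D_(e2 R) q x.
Proof.
move=> [_ p1 p2 _ _] [_ q1 q2 _ _]; rewrite /divergence.
have [_ ->] := is_derive_pair (DeriveDef (p1 x) erefl) (DeriveDef (q1 x) erefl).
by have [_ ->] := is_derive_pair (DeriveDef (p2 x) erefl) (DeriveDef (q2 x) erefl).
Qed.

Lemma divergence_fst_snd phi x : C1_field phi ->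
  divergence phi x = 'D_(e1 R) (fst \o phi) x + 'D_(e2 R) (snd \o phi) x.
Proof.
move=> [d1 d2 _ _]; rewrite /divergence.
by have [_ ->] := is_derive_fst (d1 x); have [_ ->] := is_derive_snd (d2 x).
Qed.

Lemma test_field_support Omega phi (K := closure [set x | phi x != 0]) : test_field Omega phi ->
  [/\ compact K, closed K, K `<=` Omega & forall x, ~ K x -> phi x = 0].
Proof.
move=> [_ cK KO _]; split => //; first exact: closed_closure.
by move=> x nKx; apply/eqP; apply: contra_notT nKx => px; exact: subset_closure.
Qed.

(** [C1_field] does not ask for continuity of the field itself. Compact support bounds its
    continuous partial derivatives, and bounded partial derivatives make the components
    continuous. *)
Lemma test_field_C1 Omega phi : test_field Omega phi -> C1 (fst \o phi) /\ C1 (snd \o phi).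
Proof.
move=> tphi; have [cK clK KO pK] := test_field_support tphi.
have [[d1 d2 c1 c2] _ _ _] := tphi.
set K := closure _ in cK clK pK.
have bnd (d : R * R -> R) : continuous d -> (forall x, ~ K x -> d x = 0) ->
    exists2 L, 0 <= L & forall x, `|d x| <= L.
  move=> cd dK; have [_ [M [B hMB]]] := compact_support_tame cd cK dK.
  exists (`|M|) => // x; apply: (le_trans (hMB x)); rewrite indicE.
  by case: (_ \in _); rewrite ?mulr1 ?mulr0 ?ler_norm.
have D0 x z : ~ K x -> 'D_z phi x = 0 by exact: derive_outside.
have E1 (z : R * R) : (forall x, derivable phi x z) ->
    (fun x => 'D_z (fst \o phi) x) = fst \o (fun x => 'D_z phi x).
  by move=> d; apply/funext => x; have [_ ->] := is_derive_fst (d x).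
have E2 (z : R * R) : (forall x, derivable phi x z) ->
    (fun x => 'D_z (snd \o phi) x) = snd \o (fun x => 'D_z phi x).
  by move=> d; apply/funext => x; have [_ ->] := is_derive_snd (d x).
have cf (g : R * R -> R * R) : continuous g -> continuous (fst \o g).
  by move=> cg x; apply: continuous_comp; [exact: cg|exact: cvg_fst].
have cs (g : R * R -> R * R) : continuous g -> continuous (snd \o g).
  by move=> cg x; apply: continuous_comp; [exact: cg|exact: cvg_snd].
have p1 x : derivable (fst \o phi) x (e1 R) by have [] := is_derive_fst (d1 x).
have p2 x : derivable (fst \o phi) x (e2 R) by have [] := is_derive_fst (d2 x).
have q1 x : derivable (snd \o phi) x (e1 R) by have [] := is_derive_snd (d1 x).
have q2 x : derivable (snd \o phi) x (e2 R) by have [] := is_derive_snd (d2 x).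
have cp1 : continuous (fun x => 'D_(e1 R) (fst \o phi) x) by rewrite (E1 _ d1); exact: (cf _ c1).
have cp2 : continuous (fun x => 'D_(e2 R) (fst \o phi) x) by rewrite (E1 _ d2); exact: (cf _ c2).
have cq1 : continuous (fun x => 'D_(e1 R) (snd \o phi) x) by rewrite (E2 _ d1); exact: (cs _ c1).
have cq2 : continuous (fun x => 'D_(e2 R) (snd \o phi) x) by rewrite (E2 _ d2); exact: (cs _ c2).
have z1 (p : R * R -> R) z x : (forall x, ~ K x -> p x = 0) -> ~ K x -> 'D_z p x = 0.
  by move=> p0; exact: (@derive_outside R R^o).
have fK x : ~ K x -> (fst \o phi) x = 0 by move=> /pK /= ->.
have sK x : ~ K x -> (snd \o phi) x = 0 by move=> /pK /= ->.
split; split => //.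
- have [L1 L10 hL1] := bnd _ cp1 (fun x => z1 _ _ x fK).
  have [L2 L20 hL2] := bnd _ cp2 (fun x => z1 _ _ x fK).
  apply: (@C1_lipschitz _ _ (L1 + L2)) => // x.
    by rewrite (le_trans (hL1 x))// lerDl.
  by rewrite (le_trans (hL2 x))// lerDr.
- have [L1 L10 hL1] := bnd _ cq1 (fun x => z1 _ _ x sK).
  have [L2 L20 hL2] := bnd _ cq2 (fun x => z1 _ _ x sK).
  apply: (@C1_lipschitz _ _ (L1 + L2)) => // x.
    by rewrite (le_trans (hL1 x))// lerDl.
  by rewrite (le_trans (hL2 x))// lerDr.
Qed.

Lemma compact_test_field Omega phi K : C1_field phi -> compact K -> K `<=` Omega ->
  (forall x, phi x != 0 -> K x) -> (forall x, eucl_norm (phi x) <= 1) ->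
  test_field Omega phi.
Proof.
move=> Cphi cK KO pK p1.
have clK : closed K by apply: compact_closed => //; exact: norm_hausdorff.
have sK : closure [set x | phi x != 0] `<=` K.
  by rewrite (closure_id K).1//; apply: closure_subset => x /pK.
split => //; last exact: subset_trans sK KO.
by apply: (subclosed_compact _ cK sK); exact: closed_closure.
Qed.

Lemma translate_quotient (V : normedModType R) (f : R * R -> V) x y z :
  (fun h : R => h^-1 *: (f (h *: z + x - y) - f (x - y))) =
  (fun h : R => h^-1 *: (f (h *: z + (x - y)) - f (x - y))).
Proof. by apply/funext => h; rewrite addrA. Qed.

Lemma derive_translate (V : normedModType R) (f : R * R -> V) x y z :
  'D_z (fun x => f (x - y)) x = 'D_z f (x - y).
Proof. by rewrite /derive /= translate_quotient. Qed.

Lemma derivable_translate (V : normedModType R) (f : R * R -> V) x y z :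
  derivable f (x - y) z -> derivable (fun x => f (x - y)) x z.
Proof. by rewrite /derivable /= translate_quotient. Qed.

Lemma test_field_translate Omega phi K y : test_field Omega phi -> compact K ->
  (forall x, phi x != 0 -> K x) -> (forall x, K x -> Omega (x + y)) ->
  test_field Omega (fun x => phi (x - y)).
Proof.
move=> [[d1 d2 c1 c2] _ _ p1] cK pK KO.
have cT : continuous (fun x : R * R => x - y).
  by move=> x; apply: cvgD; [exact: cvg_id|exact: cvg_cst].
apply: (@compact_test_field _ _ ((fun x => x + y) @` K)).
- split.
  + by move=> x; exact: derivable_translate.
  + by move=> x; exact: derivable_translate.
  + under eq_fun do rewrite derive_translate.
    by move=> x; exact: (continuous_comp (cT x) (c1 _)).
  + under eq_fun do rewrite derive_translate.
    by move=> x; exact: (continuous_comp (cT x) (c2 _)).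
- apply: continuous_compact => //; apply: continuous_subspaceT => x.
  by apply: cvgD; [exact: cvg_id|exact: cvg_cst].
- by move=> _ [x Kx <-]; exact: KO.
- by move=> x px; exists (x - y); [exact: pK|rewrite subrK].
- by move=> x; exact: p1.
Qed.

Lemma divergence_translate phi x y :
  divergence (fun x => phi (x - y)) x = divergence phi (x - y).
Proof. by rewrite /divergence !derive_translate. Qed.

Lemma test_field_divergence Omega phi : test_field Omega phi ->
  continuous (divergence phi) /\
  (forall x, ~ closure [set x | phi x != 0] x -> divergence phi x = 0).
Proof.
move=> tphi; have [cK clK KO pK] := test_field_support tphi.
have [[d1 d2 c1 c2] _ _ _] := tphi; split.
  move=> x; apply: cvgD.
    by apply: (@continuous_comp _ _ _ (fun x => 'D_(e1 R) phi x) fst); [exact: c1|exact: cvg_fst].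
  by apply: (@continuous_comp _ _ _ (fun x => 'D_(e2 R) phi x) snd); [exact: c2|exact: cvg_snd].
by move=> x nKx; rewrite /divergence !(derive_outside (K := closure [set x | phi x != 0]))//= addr0.
Qed.

Lemma test_field_tame Omega phi : test_field Omega phi -> tame (divergence phi).
Proof.
move=> tphi; have [cK _ _ _] := test_field_support tphi.
by have [c0 d0] := test_field_divergence tphi; exact: (compact_support_tame c0 cK d0).
Qed.

End fields.

(** * Interpolation of test fields *)

Section iterated_averages.
Context {R : realType}.
Implicit Types (x z : R * R) (v h : R * R -> R).
Local Notation mu2 := (borel_area R).

Lemma avg_unit z a v : 0 < a -> borel v -> (forall x, 0 <= v x <= 1) ->
  borel (avg z a v) /\ (forall x, 0 <= avg z a v x <= 1).
Proof.
move=> a0 bv v01.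
have vM : exists M, forall y, `|v y| <= M.
  by exists 1 => y; have := v01 y; rewrite ler_norml; lra.
split; first exact: borel_avg.
move=> x; apply/andP; split; [apply: avg_ge => //|apply: avg_le => //].
- by move=> y; case/andP: (v01 y).
- by move=> y; case/andP: (v01 y).
Qed.

Lemma unit_norm (t : R) : 0 <= t <= 1 -> `|t| <= 1.
Proof. by rewrite ler_norml; lra. Qed.

Lemma unit_subr_norm (a b : R) : 0 <= a <= 1 -> 0 <= b <= 1 -> `|a - b| <= 1.
Proof. by rewrite ler_norml; lra. Qed.

(* The two inner averages make the function Lipschitz.  Averages commute, so either
   direction can be made the outermost one, whose average is differentiable in that
   direction with a difference quotient as derivative. *)
Lemma avg4_C1 a b c d v : 0 < a -> 0 < b -> 0 < c -> 0 < d -> borel v ->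
  (forall x, 0 <= v x <= 1) ->
  C1 (avg (e1 R) a (avg (e2 R) c (avg (e1 R) b (avg (e2 R) d v)))).
Proof.
move=> a0 b0 c0 d0 bv v01.
have [b1 u1] := avg_unit (e2 R) d0 bv v01.
have [b2 u2] := avg_unit (e1 R) b0 b1 u1.
pose q := avg (e1 R) b (avg (e2 R) d v).
have [b3 u3] := avg_unit (e2 R) c0 b2 u2.
have [b3' u3'] := avg_unit (e1 R) a0 b2 u2.
pose L := 2 * 1 / b + 2 * 1 / d.
have L1 x t : `|q (x + t *: e1 R) - q x| <= L * `|t|.
  apply: (le_trans (avg_lipschitz _ x t b0 b1 (fun y => unit_norm (u1 y)))).
  by rewrite ler_wpM2r// lerDl divr_ge0 ?ltW// mulr_gt0.
have L2 x t : `|q (x + t *: e2 R) - q x| <= L * `|t|.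
  apply: (@avg_keeps_lipschitz _ (e1 R) (e2 R) b _ 1 L b0 b1
    (fun y => unit_norm (u1 y))) => {}x {}t.
  apply: (le_trans (avg_lipschitz _ x t d0 bv (fun y => unit_norm (v01 y)))).
  by rewrite ler_wpM2r// lerDr divr_ge0 ?ltW// mulr_gt0.
have b2' := b2; have u2n y := unit_norm (u2 y).
have K z e : 0 < e -> (forall x t, `|avg z e q (x + t *: e1 R) - avg z e q x| <= L * `|t|) /\
    (forall x t, `|avg z e q (x + t *: e2 R) - avg z e q x| <= L * `|t|).
  move=> e0; split.
    exact: (@avg_keeps_lipschitz _ z (e1 R) e q 1 L e0 b2 u2n L1).
  exact: (@avg_keeps_lipschitz _ z (e2 R) e q 1 L e0 b2 u2n L2).
have cp : continuous (avg (e2 R) c q).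
  by have [k1 k2] := K (e2 R) c c0; exact: lipschitz_e1_e2_continuous k1 k2.
have cp' : continuous (avg (e1 R) a q).
  by have [k1 k2] := K (e1 R) a a0; exact: lipschitz_e1_e2_continuous k1 k2.
set w := avg (e1 R) a _.
have wE : w = avg (e2 R) c (avg (e1 R) a q).
  by apply/funext => x; exact: avgC b2 u2n.
have D1 x : is_derive x (e1 R) w (a^-1 * (avg (e2 R) c q (x + a *: e1 R) - avg (e2 R) c q x)).
  exact: (avg_is_derive _ x a0 cp (fun y => unit_norm (u3 y))).
have D2 x : is_derive x (e2 R) w (c^-1 * (avg (e1 R) a q (x + c *: e2 R) - avg (e1 R) a q x)).
  by rewrite wE; exact: (avg_is_derive _ x c0 cp' (fun y => unit_norm (u3' y))).
have cq (f : R * R -> R) (k : R) z : continuous f -> continuous (fun x => k * (f (x + z) - f x)).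
  move=> cf x; apply: cvgM; first exact: cvg_cst.
  apply: cvgB; last exact: cf.
  apply: (@continuous_comp _ _ _ (fun x => x + z) f); last exact: cf.
  by apply: cvgD; [exact: cvg_id|exact: cvg_cst].
split.
- have [k1 k2] := K (e2 R) c c0.
  have u3n y := unit_norm (u3 y).
  exact: (@lipschitz_e1_e2_continuous _ _ L
    (@avg_keeps_lipschitz _ (e1 R) (e1 R) a _ 1 L a0 b3 u3n k1)
    (@avg_keeps_lipschitz _ (e1 R) (e2 R) a _ 1 L a0 b3 u3n k2)).
- by move=> x; have [] := D1 x.
- by move=> x; have [] := D2 x.
- rewrite (_ : (fun x => 'D_(e1 R) w x) =
    (fun x => a^-1 * (avg (e2 R) c q (x + a *: e1 R) - avg (e2 R) c q x))).
    exact: cq.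
  by apply/funext => x; have [_ ->] := D1 x.
- rewrite (_ : (fun x => 'D_(e2 R) w x) =
    (fun x => c^-1 * (avg (e1 R) a q (x + c *: e2 R) - avg (e1 R) a q x))).
    exact: cq.
  by apply/funext => x; have [_ ->] := D2 x.
Qed.

(** Each average costs a translation of [h] by at most [a] along its axis. There are two averages
    per axis, hence [2 * a]. *)
Lemma avg4_int_le a v h T : 0 < a -> borel v -> (forall x, 0 <= v x <= 1) -> tame h ->
  (forall y : R * R, `|y.1| <= 2 * a -> `|y.2| <= 2 * a ->
    \int[mu2]_x (v x * h (x - y)) <= T) ->
  forall a1 a2 a3 a4, 0 < a1 <= a -> 0 < a2 <= a -> 0 < a3 <= a -> 0 < a4 <= a ->
  \int[mu2]_x (avg (e1 R) a1 (avg (e2 R) a2 (avg (e1 R) a3 (avg (e2 R) a4 v))) x * h x) <= T.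
Proof.
move=> a0 bv v01 th hT a1 a2 a3 a4 /andP[p1 q1] /andP[p2 q2] /andP[p3 q3] /andP[p4 q4].
have [b4 u4] := avg_unit (e2 R) p4 bv v01.
have [b3 u3] := avg_unit (e1 R) p3 b4 u4.
have [b2 u2] := avg_unit (e2 R) p2 b3 u3.
have ts z : tame (fun x => h (x - z)) by exact: tame_shift.
apply: (avg_int_le p1 b2 (fun y => unit_norm (u2 y))) => // s1 /andP[s10 s11].
apply: (avg_int_le p2 b3 (fun y => unit_norm (u3 y))) => // s2 /andP[s20 s21].
apply: (avg_int_le p3 b4 (fun y => unit_norm (u4 y))) => [|s3 /andP[s30 s31]].
  exact: (tame_shift (- (s2 *: e2 R)) (ts (s1 *: e1 R))).
apply: (avg_int_le p4 bv (fun y => unit_norm (v01 y))) => [|s4 /andP[s40 s41]].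
  exact: (tame_shift (- (s3 *: e1 R)) (tame_shift (- (s2 *: e2 R)) (ts (s1 *: e1 R)))).
apply: le_trans (hT (s1 + s3, s2 + s4) _ _); last 2 first.
- by rewrite /= ger0_norm; lra.
- by rewrite /= ger0_norm; lra.
rewrite le_eqVlt; apply/orP; left; apply/eqP; apply: eq_Rintegral => x _.
congr (_ * h _); rewrite /e1 /e2; case: x => x1 x2.
by congr pair; rewrite /= /GRing.scale/=; ring.
Qed.

End iterated_averages.

(** * One-sided coarea inequality for a smooth contraction *)

Section contraction.
Context {R : realType} (g k k' : R -> R).
Hypotheses (dg : forall t, is_derive t (1 : R) g (k t))
  (dk : forall t, is_derive t (1 : R) k (k' t))
  (ck' : continuous k') (k01 : forall t, 0 <= k t <= 1).
Local Notation mu2 := (borel_area R).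

(** The mean value theorem writes the two increments as [c] and [1 - c] times [s - t], with the same
    [c] in [0, 1]. *)
Lemma contraction_lipschitz s t : `|g s - g t| <= `|s - t| /\ `|(s - g s) - (t - g t)| <= `|s - t|.
Proof.
have cg : continuous g.
  exact: is_derive_continuous dg.
have H (a b : R) : a <= b -> exists2 c, 0 <= c <= 1 & g b - g a = c * (b - a).
  move=> ab; have [c _ E] := @MVT_segment R _ _ a b ab (fun s _ => dg s) (continuous_subspaceT cg).
  by exists (k c).
wlog st : s t / t <= s.
  move=> W; have [ts|/ltW ts] := leP t s; first exact: W.
  by rewrite !(distrC s) (distrC (g s)) (distrC (s - g s)); exact: W.
have [c c01 E] := H _ _ st.
have st0 : 0 <= s - t by rewrite subr_ge0.
rewrite [`|s - t|]ger0_norm// (_ : s - g s - (t - g t) = (1 - c) * (s - t)); last first.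
  by rewrite mulrBl mul1r -E; ring.
rewrite E !normrM (ger0_norm st0) !ler_piMl// ?ger0_norm; lra.
Qed.

Variable Omega : set (R * R).
Variables phi psi : R * R -> R * R.
Hypotheses (tphi : test_field Omega phi) (tpsi : test_field Omega psi).

Definition interpolate (w : R * R -> R) (x : R * R) : R * R :=
  (k (w x) * (phi x).1 + (1 - k (w x)) * (psi x).1,
   k (w x) * (phi x).2 + (1 - k (w x)) * (psi x).2).

(** This set contains the support of [interpolate w] for every [w], so the size of the admissible
    translations does not depend on [w]. *)
Let K := closure [set x | phi x != 0] `|` closure [set x | psi x != 0].

Let cK : compact K.
Proof.
have [c1 _ _ _] := test_field_support tphi; have [c2 _ _ _] := test_field_support tpsi.
exact: compactU.
Qed.

Let KO : K `<=` Omega.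
Proof.
have [_ _ k1 _] := test_field_support tphi; have [_ _ k2 _] := test_field_support tpsi.
by move=> x [/k1|/k2].
Qed.

Let phi0 x : ~ K x -> phi x = 0.
Proof.
by have [_ _ _ p] := test_field_support tphi; move=> nK; apply: p => ?; apply: nK; left.
Qed.

Let psi0 x : ~ K x -> psi x = 0.
Proof.
by have [_ _ _ p] := test_field_support tpsi; move=> nK; apply: p => ?; apply: nK; right.
Qed.

Lemma interpolate_outside w x : ~ K x -> interpolate w x = 0.
Proof.
by move=> nK; rewrite /interpolate phi0// psi0//= !mulr0 addr0.
Qed.

Let onem_comp w : C1 w -> C1 (fun x => 1 - k (w x)).
Proof.
move=> Cw; apply: (@C1_comp _ (fun t => 1 - k t) (fun t => - k' t) w Cw).
  by move=> t; apply: cvgN; exact: ck'.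
move=> t; have := is_deriveB (is_derive_cst (1 : R) t (1 : R)) (dk t).
by rewrite sub0r.
Qed.

Lemma interpolate_components w : C1 w ->
  C1 (fun x => (interpolate w x).1) /\ C1 (fun x => (interpolate w x).2).
Proof.
move=> Cw; have [f1 f2] := test_field_C1 tphi; have [s1 s2] := test_field_C1 tpsi.
have Ck := C1_comp Cw ck' dk; have Ck1 := onem_comp Cw.
split; [exact: (C1D (C1M Ck f1) (C1M Ck1 s1))|exact: (C1D (C1M Ck f2) (C1M Ck1 s2))].
Qed.

Lemma interpolate_test_field w : C1 w -> test_field Omega (interpolate w).
Proof.
move=> Cw; have [i1 i2] := interpolate_components Cw.
apply: (@compact_test_field _ _ _ K) => //.
- exact: C1_field_pair i1 i2.
- by move=> x ix; apply: contrapT => nK; move: ix; rewrite interpolate_outside// eqxx.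
move=> x; have [_ _ _ /(_ x)] := tphi; have [_ _ _ /(_ x)] := tpsi.
have sq (t : R) : (Num.sqrt t <= 1) = (t <= 1) by rewrite -{1}sqrtr1 ler_sqrt.
rewrite /eucl_norm !sq /interpolate/=.
have := k01 (w x).
move: (k _) (phi x).1 (phi x).2 (psi x).1 (psi x).2 => c a1 a2 b1 b2 c01 hb ha.
have p0 : 0 <= c * (1 - c) by apply: mulr_ge0; lra.
have p1 := mulr_ge0 p0 (sqr_ge0 (a1 - b1)); have p2 := mulr_ge0 p0 (sqr_ge0 (a2 - b2)).
have h1 : c * (a1 ^+ 2 + a2 ^+ 2) <= c by rewrite ler_piMr; lra.
have h2 : (1 - c) * (b1 ^+ 2 + b2 ^+ 2) <= 1 - c by rewrite ler_piMr; lra.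
(* Convexity of the squared Euclidean norm with its exact defect: the subtracted terms are
   [c (1 - c)] times the squared distance between the two vectors. *)
have -> : (c * a1 + (1 - c) * b1) ^+ 2 + (c * a2 + (1 - c) * b2) ^+ 2 =
  c * (a1 ^+ 2 + a2 ^+ 2) + (1 - c) * (b1 ^+ 2 + b2 ^+ 2) -
  c * (1 - c) * (a1 - b1) ^+ 2 - c * (1 - c) * (a2 - b2) ^+ 2 by ring.
lra.
Qed.

(* [interpolate_integral] below holds because the difference of its integrands is the
   divergence of the compactly supported field (w k(w) - g(w)) (phi - psi). *)
Let defect w (p q : R * R -> R) x := (w x * k (w x) - g (w x)) * (p x - q x).

Let C1_g w : C1 w -> C1 (fun x => g (w x)).
Proof.
move=> Cw; apply: (C1_comp Cw _ dg) => t.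
by apply/differentiable_continuous/derivable1_diffP; have [] := dk t.
Qed.

Let C1_defect w p q : C1 w -> C1 p -> C1 q -> C1 (defect w p q).
Proof.
move=> Cw Cp Cq; apply: C1M.
  by apply: C1D; [apply: C1M => //; exact: (C1_comp Cw ck' dk)|apply: C1N; exact: C1_g].
by apply: C1D => //; exact: C1N.
Qed.

(** Since [k] is the derivative of [g], the two terms k(w) Dw in the derivative of w k(w) - g(w)
    cancel, and only [w] times the derivative of k(w) remains. *)
Let defect_is_derive w p q x z :
  derivable w x z -> derivable p x z -> derivable q x z ->
  'D_z (defect w p q) x =
    w x * 'D_z (fun x => k (w x) * p x + (1 - k (w x)) * q x) x
    - g (w x) * 'D_z p x - (w x - g (w x)) * 'D_z q x.
Proof.
move=> dw dp dq.
have Dw := DeriveDef dw erefl; have Dp := DeriveDef dp erefl; have Dq := DeriveDef dq erefl.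
have Dg := is_derive_comp1 (dg (w x)) Dw; have Dk := is_derive_comp1 (dk (w x)) Dw.
have D1 := is_deriveM (is_deriveB (is_deriveM Dw Dk) Dg) (is_deriveB Dp Dq).
have D2 := is_deriveD (is_deriveM Dk Dp)
  (is_deriveM (is_deriveB (is_derive_cst (1 : R) x z) Dk) Dq).
have [_ E1] := D1; have [_ E2] := D2.
rewrite [LHS]E1 [X in w x * X - _ - _]E2 /= /GRing.scale/= !fctE; ring.
Qed.

Lemma interpolate_integral w : C1 w -> borel w -> (forall x, 0 <= w x <= 1) ->
  \int[mu2]_x (w x * divergence (interpolate w) x) =
  \int[mu2]_x (g (w x) * divergence phi x) + \int[mu2]_x ((w x - g (w x)) * divergence psi x).
Proof.
move=> Cw bw w01.
have [f1 f2] := test_field_C1 tphi; have [s1 s2] := test_field_C1 tpsi.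
have [i1 i2] := interpolate_components Cw.
have cg : continuous g.
  exact: is_derive_continuous dg.
have mg : measurable_fun setT g by exact: continuous_measurable_fun.
have bgw : borel (fun x => g (w x)) by exact: measurableT_comp.
have gb x : `|g (w x)| <= `|g 0| + 1.
  have [+ _] := contraction_lipschitz (w x) 0; rewrite subr0 => h.
  have := ler_normD (g (w x) - g 0) (g 0); rewrite subrK => h1.
  by have := unit_norm (w01 x); lra.
have gb2 x : `|w x - g (w x)| <= `|g 0| + 2.
  by rewrite (le_trans (ler_normB _ _))//; have := gb x; have := unit_norm (w01 x); lra.
have t1 : tame (fun x => w x * divergence (interpolate w) x).
  apply: (tameM bw (fun x => unit_norm (w01 x))).
  exact: test_field_tame (interpolate_test_field Cw).
have t2 : tame (fun x => g (w x) * divergence phi x).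
  by apply: (tameM bgw gb); exact: test_field_tame tphi.
have t3 : tame (fun x => (w x - g (w x)) * divergence psi x).
  by apply: (tameM _ gb2); [exact: measurable_funB|exact: test_field_tame tpsi].
pose F1 := defect w (fst \o phi) (fst \o psi).
pose F2 := defect w (snd \o phi) (snd \o psi).
have CF1 : C1 F1 by exact: C1_defect.
have CF2 : C1 F2 by exact: C1_defect.
have F10 x : ~ K x -> F1 x = 0.
  by move=> nK; rewrite /F1 /defect /= phi0// psi0//= subr0 mulr0.
have F20 x : ~ K x -> F2 x = 0.
  by move=> nK; rewrite /F2 /defect /= phi0// psi0//= subr0 mulr0.
have clK : closed K by apply: compact_closed => //; exact: norm_hausdorff.
have dF1 x : ~ K x -> 'D_(e1 R) F1 x = 0 by exact: (@derive_outside R R^o).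
have dF2 x : ~ K x -> 'D_(e2 R) F2 x = 0 by exact: (@derive_outside R R^o).
have I1 : \int[mu2]_x 'D_(e1 R) F1 x = 0.
  have [c0 d1 _ c1 _] := CF1.
  exact: (@Rintegral_derive0 R F1 (fun x => 'D_(e1 R) F1 x) (e1 R) K c1 cK
    (fun x => DeriveDef (d1 x) erefl) c0 F10 dF1).
have I2 : \int[mu2]_x 'D_(e2 R) F2 x = 0.
  have [c0 _ d2 _ c2] := CF2.
  exact: (@Rintegral_derive0 R F2 (fun x => 'D_(e2 R) F2 x) (e2 R) K c2 cK
    (fun x => DeriveDef (d2 x) erefl) c0 F20 dF2).
have tD1 : tame (fun x => 'D_(e1 R) F1 x).
  by have [_ _ _ c1 _] := CF1; exact: compact_support_tame c1 cK dF1.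
have tD2 : tame (fun x => 'D_(e2 R) F2 x).
  by have [_ _ _ _ c2] := CF2; exact: compact_support_tame c2 cK dF2.
apply/eqP; rewrite -subr_eq0 opprD addrA; apply/eqP.
rewrite -(RintegralB measurableT (tame_integrable t1) (tame_integrable t2)).
rewrite -(RintegralB measurableT (integrableB measurableT (tame_integrable t1)
  (tame_integrable t2)) (tame_integrable t3)).
transitivity (\int[mu2]_x 'D_(e1 R) F1 x + \int[mu2]_x 'D_(e2 R) F2 x); last by rewrite I1 I2 addr0.
rewrite -(RintegralD measurableT (tame_integrable tD1) (tame_integrable tD2)).
apply: eq_Rintegral => x _.
have [_ wd1 wd2 _ _] := Cw.
have [_ fd1 _ _ _] := f1; have [_ _ fd2 _ _] := f2.
have [_ sd1 _ _ _] := s1; have [_ _ sd2 _ _] := s2.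
rewrite (defect_is_derive (wd1 x) (fd1 x) (sd1 x)) (defect_is_derive (wd2 x) (fd2 x) (sd2 x)).
have [Cphi _ _ _] := tphi; have [Cpsi _ _ _] := tpsi.
rewrite (divergence_fst_snd x Cphi) (divergence_fst_snd x Cpsi).
rewrite (divergence_pair x i1 i2) /=; ring.
Qed.

Lemma interpolation_bound (v : R * R -> R) (T : R) : open Omega -> borel v ->
  (forall x, 0 <= v x <= 1) ->
  (forall theta, test_field Omega theta -> \int[mu2]_x (v x * divergence theta x) <= T) ->
  \int[mu2]_x (g (v x) * divergence phi x) + \int[mu2]_x ((v x - g (v x)) * divergence psi x) <= T.
Proof.
move=> oO bv v01 vT.
have [r r0 hr] : exists2 r : R, 0 < r & forall y : R * R, `|y.1| <= r -> `|y.2| <= r ->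
    forall x, K x -> Omega (x + y).
  have /compact_near_coveringP nK := cK.
  have cov : \forall y \near (0 : R * R), K `<=` (fun x => Omega (x + y)).
    apply: (nK (R * R)%type (nbhs (0 : R * R)) (fun y x => Omega (x + y))) => x Kx.
    have := @add_continuous (R * R)%type (x, 0); rewrite /continuous_at/= addr0.
    by apply; apply: open_nbhs_nbhs; split => //; exact: KO.
  have /nbhs_ballP[e /= e0 he] := cov.
  exists (e / 2); first by rewrite divr_gt0.
  move=> y y1 y2; apply: he; split; rewrite /ball/= sub0r normrN; lra.
(* Half the radius: two averages of length at most [a] along each axis shift a point by at most [r]
   in each coordinate. *)
pose a := r / 2.
have a0 : 0 < a by rewrite divr_gt0.
pose Phi (w : R * R -> R) := \int[mu2]_x (g (w x) * divergence phi x) +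
  \int[mu2]_x ((w x - g (w x)) * divergence psi x).
(* One average is removed at a time while the inner ones stay fixed. The limit is thus an iterated
   one, without any relation between the four lengths. *)
have lim z w : borel w -> (forall x, 0 <= w x <= 1) ->
    (forall n, Phi (avg z (a / n.+1%:R) w) <= T) -> Phi w <= T.
  move=> bw w01 hn.
  have cg : continuous g.
    exact: is_derive_continuous dg.
  have mg : measurable_fun setT g by exact: continuous_measurable_fun.
  have l1 := avg_comp_cvg z a0 bw w01 (test_field_tame tphi) mg
    (fun s t _ _ => (contraction_lipschitz s t).1).
  have l2 := @avg_comp_cvg R z a w _ (fun t => t - g t) a0 bw w01 (test_field_tame tpsi)
    ltac:(exact: measurable_funB) (fun s t _ _ => (contraction_lipschitz s t).2).
  have l : (fun n => Phi (avg z (a / n.+1%:R) w)) @ \oo --> Phi w by exact: cvgD l1 l2.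
  rewrite -(cvg_lim _ l)//; apply: limr_le; first by apply/cvg_ex; exists (Phi w).
  by apply: nearW => n; exact: hn.
have shifted w y : C1 w -> (forall x, K x -> Omega (x + y)) ->
    \int[mu2]_x (v x * divergence (interpolate w) (x - y)) <= T.
  move=> Cw Ky; have ty : test_field Omega (fun x => interpolate w (x - y)).
    apply: (test_field_translate (interpolate_test_field Cw) cK) => // x ix.
    by apply: contrapT => nK; move: ix; rewrite interpolate_outside// eqxx.
  apply: le_trans (vT _ ty); rewrite le_eqVlt; apply/orP; left; apply/eqP.
  by apply: eq_Rintegral => x _; rewrite (divergence_translate (interpolate w)).
have an n : 0 < a / n.+1%:R <= a.
  by rewrite divr_gt0//= ler_pdivrMr// ler_peMr ?ler1n// ltW.
apply: (lim (e2 R)) => // n4; have /andP[p4 q4] := an n4.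
have [b4 u4] := avg_unit (e2 R) p4 bv v01.
apply: (lim (e1 R)) => // n3; have /andP[p3 q3] := an n3.
have [b3 u3] := avg_unit (e1 R) p3 b4 u4.
apply: (lim (e2 R)) => // n2; have /andP[p2 q2] := an n2.
have [b2 u2] := avg_unit (e2 R) p2 b3 u3.
apply: (lim (e1 R)) => // n1; have /andP[p1 q1] := an n1.
have [b1 u1] := avg_unit (e1 R) p1 b2 u2.
have Cw := avg4_C1 p1 p3 p2 p4 bv v01.
rewrite /Phi -(interpolate_integral Cw b1 u1).
apply: (avg4_int_le a0) => //; first exact: test_field_tame (interpolate_test_field Cw).
by move=> y y1 y2; apply: shifted => //; apply: hr; rewrite (le_trans y1, le_trans y2)// /a; lra.
Qed.

End contraction.

(** * Lebesgue measurable functions of the plane *)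

Local Opaque divergence.

Section area_theory.
Context {R : realType}.
Implicit Types (u v h : R * R -> R) (Omega A : set (R * R)).
Local Notation mu2 := (borel_area R).
Local Notation lp := (leb_plane R).

Lemma area_borel A : measurable (A : set (plane R)) -> area (A : set lp) = mu2 A.
Proof. by move=> mA; rewrite /area /completed_measure_extension measurable_mu_extE. Qed.

Lemma borel_leb_measurable A : measurable (A : set (plane R)) -> measurable (A : set lp).
Proof. by move=> mA; exact: caratheodory_measurable_mu_ext. Qed.

Lemma measurable_id_leb : measurable_fun setT (fun x : lp => x : plane R).
Proof. by move=> _ A mA; rewrite setTI; exact: borel_leb_measurable. Qed.

Lemma borel_leb_fun v : borel v -> measurable_fun (setT : set lp) (v : lp -> R).
Proof. by move=> bv; apply: (measurableT_comp bv); exact: measurable_id_leb. Qed.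

Lemma integral_area (f : plane R -> \bar R) : measurable_fun setT f ->
  (\int[@area R]_x f x = \int[mu2]_x f x)%E.
Proof.
move=> mf; exact: (@integral_preserving _ _ lp (plane R) R (@area R) mu2
  (fun x : lp => x : plane R) measurable_id_leb (fun A mA => area_borel mA) f mf).
Qed.

(** The area is an outer measure, an infimum over countable Borel covers. The intersection of covers
    with excess at most 1 / (n + 1) has excess zero, and finite area lets the excess be computed by
    subtraction. *)
Lemma borel_hull A : measurable (A : set lp) -> (area (A : set lp) < +oo)%E ->
  exists B : set (R * R), [/\ measurable (B : set (plane R)), A `<=` B &
    area (B `\` A : set lp) = 0%E].
Proof.
move=> mA Afin.
have inv0 n : (0 < n.+1%:R^-1 :> R) by rewrite invr_gt0.
have cover n : exists B : set (R * R), [/\ measurable (B : set (plane R)), A `<=` B &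
    (mu2 B <= area (A : set lp) + (n.+1%:R^-1)%:E)%E].
  have Afn : area (A : set lp) \is a fin_num by rewrite ge0_fin_numE.
  have [_ /= [F [mF AF] <-] hF] := lb_ereal_inf_adherent (inv0 n) Afn.
  exists (\bigcup_k F k); split => //; first exact: bigcupT_measurable.
  apply: le_trans (ltW hF); apply: measure_sigma_subadditive => //.
  exact: bigcupT_measurable.
pose B n := projT1 (cid (cover n)).
have hB n : [/\ measurable (B n : set (plane R)), A `<=` B n &
    (mu2 (B n) <= area (A : set lp) + (n.+1%:R^-1)%:E)%E].
  by rewrite /B; case: cid.
have mB : measurable (\bigcap_n B n : set (plane R)).
  by apply: bigcapT_measurable => n; have [] := hB n.
have AB : A `<=` \bigcap_n B n by move=> x Ax n _; have [_ + _] := hB n; exact.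
exists (\bigcap_n B n); split => //.
have mBl := borel_leb_measurable mB.
apply/eqP; rewrite -measure_le0 measureD//; last first.
  apply: (@le_lt_trans _ _ (area (B 0%N : set lp))).
    apply: le_measure; rewrite ?inE//.
      by apply: borel_leb_measurable; have [] := hB 0%N.
    by move=> x; apply.
  have [m0 _ h0] := hB 0%N; rewrite area_borel//; apply: (le_lt_trans h0).
  by rewrite lte_add_pinfty// ltry.
have -> : (\bigcap_n B n `&` A) = A by apply/seteqP; split => [x []//|x Ax]; split => //; exact: AB.
have Afn : area (A : set lp) \is a fin_num by rewrite ge0_fin_numE.
rewrite leeBlDr// add0e; apply/lee_addgt0Pr => e e0.
near \oo => n.
apply: (@le_trans _ _ (area (B n : set lp))).
  apply: le_measure; rewrite ?inE//.
    by apply: borel_leb_measurable; have [] := hB n.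
  by move=> x; apply.
have [mn _ hn] := hB n; rewrite area_borel//; apply: (le_trans hn).
rewrite leeD2l// lee_fin ltW//.
by near: n; exact: near_infty_natSinv_lt (PosNum e0).
Unshelve. all: by end_near. Qed.

Lemma open_leb_measurable Omega : open Omega -> measurable (Omega : set lp).
Proof. by move=> oO; apply: borel_leb_measurable; exact: open_measurable_plane. Qed.

Lemma bounded_area Omega : open Omega -> bounded_set Omega -> (area (Omega : set lp) < +oo)%E.
Proof.
move=> oO [M [_ hM]].
have mO := open_measurable_plane oO; rewrite area_borel//.
have hO x : Omega x -> `|x.1| <= M + 1 /\ `|x.2| <= M + 1.
  move=> Ox; have := hM (M + 1) ltac:(by rewrite ltrDl) x Ox.
  by rewrite /= /Num.norm/= ge_max => /andP[].
have /integrableP[_] := @box_integrable R 1 (M + 1); apply: le_lt_trans.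
rewrite -(setIT Omega) -integral_indic//; apply: ge0_le_integral => //.
- by apply/measurable_EFinP; exact: measurable_indic.
- apply: measurableT_comp => //; exact: (measurable_int _ (box_integrable 1 (M + 1))).
- move=> x _; rewrite lee_fin mul1r; apply: le_trans (ler_norm _).
  rewrite !indicE; have [Ox|nOx] := pselect (Omega x).
    by rewrite !mem_set//=; exact: hO.
  by rewrite memNset.
Qed.

(* With q enumerating the rationals and B n a Borel hull of {u > q n}, the function v
   is the supremum of the functions (q n) 1_(B n), q n being clipped to [0, 1]. *)
Lemma borel_representative Omega u : open Omega -> bounded_set Omega ->
  leb_measurable_fun Omega u -> unit_valued Omega u ->
  exists v, [/\ borel v, forall x, 0 <= v x <= 1 &
    {ae @area R, forall x : lp, Omega x -> v x = u x}].
Proof.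
move=> oO bO mu u01.
pose q (n : nat) : R := if unpickle n is Some r then ratr (r : rat) else 0.
pose A n : set (R * R) := Omega `&` [set x | q n < u x].
have mO := open_leb_measurable oO.
have mA n : measurable (A n : set lp).
  have -> : A n = Omega `&` u @^-1` `]q n, +oo[.
    by apply/seteqP; split => x /=; rewrite /A/= in_itv/= andbT.
  exact: mu.
have finA n : (area (A n : set lp) < +oo)%E.
  apply: le_lt_trans (bounded_area oO bO).
  by apply: le_measure; rewrite ?inE//; exact: subIsetl.
pose B n := projT1 (cid (borel_hull (mA n) (finA n))).
have hB n : [/\ measurable (B n : set (plane R)), A n `<=` B n & area (B n `\` A n : set lp) = 0%E].
  by rewrite /B; case: cid.
pose c n : R := Num.max 0 (Num.min 1 (q n)).
have c01 n : 0 <= c n <= 1.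
  by rewrite /c le_max lexx/= ge_max ler01 ge_min lexx.
pose w n (x : R * R) : R := c n * \1_(B n) x.
have w01 n x : 0 <= w n x <= 1.
  rewrite /w indicE; case: (_ \in _); rewrite ?mulr1// mulr0 lexx ler01//.
have ub x : has_ubound (range (w ^~ x)).
  by exists 1 => _ [n _ <-]; case/andP: (w01 n x).
(* The tail supremum from index 0 is the plain supremum; in the form [sups] it is known to be
   measurable. *)
have supE x : sups (w ^~ x) 0 = sup (range (w ^~ x)).
  by rewrite /sups/=; congr sup; apply/seteqP; split => [_ [n _ <-]|_ [n _ <-]]; exists n.
have neq x : range (w ^~ x) !=set0 by exists (w 0%N x), 0%N.
exists (fun x => sups (w ^~ x) 0); split.
- apply: measurable_fun_sups => [x _|n]; first exact: ub.
  by apply: measurable_funM => //; apply: measurable_indic; have [] := hB n.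
- move=> x; rewrite supE; apply/andP; split.
    have /andP[w0 _] := w01 0%N x; apply: (le_trans w0).
    by apply: ub_le_sup => //; exists 0%N.
  by apply: ge_sup => // _ [n _ <-]; case/andP: (w01 n x).
have neg n : (@area R).-negligible (B n `\` A n : set lp).
  exists (B n `\` A n); split => //; last by have [] := hB n.
  by apply: measurableD => //; apply: borel_leb_measurable; have [] := hB n.
apply: negligibleS (negligible_bigcup neg).
move=> x /= /not_implyP[Ox]; apply: contra_notP => nU; rewrite supE.
have ux := u01 x Ox.
have wE n : w n x = if q n < u x then c n else 0.
  rewrite /w indicE; case: ifPn => qn.
    by rewrite mem_set ?mulr1//; have [_ + _] := hB n; apply; split.
  rewrite memNset ?mulr0// => Bx; apply: nU; exists n => //; split => // -[_ /=].
  exact/negP.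
apply/eqP; rewrite eq_le; apply/andP; split.
  apply: ge_sup => // _ [n _ <-]; rewrite wE; case: ifPn => [qn|_]; last by case/andP: ux.
  rewrite /c ge_max; case/andP: ux => -> _ /=.
  by rewrite ge_min (ltW qn) orbT.
have w0 : 0 <= sup (range (w ^~ x)).
  by have /andP[w0 _] := w01 0%N x; apply: (le_trans w0); apply: ub_le_sup => //; exists 0%N.
rewrite leNgt; apply/negP => su.
have [r] := rat_in_itvoo su; rewrite in_itv/= => /andP[r1 r2].
have qr : q (pickle r) = ratr r by rewrite /q pickleK.
suff : ratr r <= sup (range (w ^~ x)) by rewrite leNgt r1.
have -> : ratr r = w (pickle r) x.
  rewrite wE qr r2 /c qr min_r ?max_r//.
    by rewrite (le_trans w0)// ltW.
  by rewrite (le_trans (ltW r2))//; case/andP: ux.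
by apply: ub_le_sup => //; exists (pickle r).
Qed.

(** Since [h] vanishes off [Omega], the integral extends to the whole plane, where area and Borel
    product measure give the same integral to Borel functions. *)
Lemma integral_representative Omega u v h (k : R -> R) : open Omega ->
  leb_measurable_fun Omega u -> borel v -> {ae @area R, forall x : lp, Omega x -> v x = u x} ->
  measurable_fun setT k -> borel h -> (forall x, ~ Omega x -> h x = 0) ->
  (\int[@area R]_(x in Omega) (k (u x) * h x)%:E = \int[mu2]_x (k (v x) * h x)%:E)%E.
Proof.
move=> oO mu bv vu mk bh h0.
have mO := open_leb_measurable oO.
have bkv : borel (fun x => k (v x) * h x) by apply: measurable_funM => //; exact: measurableT_comp.
transitivity (\int[@area R]_(x in Omega) (k (v x) * h x)%:E)%E.
  apply: (@ae_eq_integral _ lp R (@area R) Omega _ _ mO).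
  - apply/measurable_EFinP; apply: measurable_funM; first exact: (measurableT_comp mk).
    by apply: measurable_funTS; exact: borel_leb_fun.
  - by apply/measurable_EFinP; apply: measurable_funTS; exact: borel_leb_fun.
  - by apply: filterS vu => x vu Ox /=; rewrite vu.
rewrite integral_mkcond -integral_area; last exact/measurable_EFinP.
apply: eq_integral => x _; rewrite patchE; case: ifPn => // /negP.
by rewrite inE => nO; rewrite h0// mulr0.
Qed.

(** Passing to a Borel representative changes none of the integrals, neither the two on the left nor
    those whose supremum is [TV Omega u]. *)
Lemma TV_interpolation Omega u (T : R) (g k k' : R -> R) phi psi :
  open Omega -> bounded_set Omega ->
  leb_measurable_fun Omega u -> unit_valued Omega u -> (TV Omega u <= T%:E)%E ->
  (forall t, is_derive t (1 : R) g (k t)) -> (forall t, is_derive t (1 : R) k (k' t)) ->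
  continuous k' -> (forall t, 0 <= k t <= 1) ->
  test_field Omega phi -> test_field Omega psi ->
  \int[@area R]_(x in Omega) (g (u x) * divergence phi x) +
  \int[@area R]_(x in Omega) ((u x - g (u x)) * divergence psi x) <= T.
Proof.
move=> oO bO mu u01 TVT dg dk ck' k01 tphi tpsi.
have [v [bv v01 vu]] := borel_representative oO bO mu u01.
have cg : continuous g.
  exact: is_derive_continuous dg.
have mg : measurable_fun setT g by exact: continuous_measurable_fun.
have d0 theta : test_field Omega theta -> forall x, ~ Omega x -> divergence theta x = 0.
  move=> tt x nO; have [_ d0] := test_field_divergence tt; apply: d0 => cx; apply: nO.
  by have [_ _ + _] := test_field_support tt; apply.
have E1 := integral_representative oO mu bv vu mg (test_field_tame tphi).1 (d0 _ tphi).
have mid : measurable_fun setT (fun t : R => t - g t) by exact: measurable_funB.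
have E2 := integral_representative oO mu bv vu mid (test_field_tame tpsi).1 (d0 _ tpsi).
rewrite /Rintegral [X in fine X + _]E1 [X in _ + fine X]E2 {E1 E2}.
apply: (interpolation_bound dg dk ck' k01 tphi tpsi oO bv v01) => theta tt.
have tv : tame (fun x => v x * divergence theta x).
  by apply: (tameM bv (fun x => unit_norm (v01 x))); exact: test_field_tame tt.
rewrite -lee_fin /Rintegral fineK; last exact: integrable_fin_num (tame_integrable tv).
rewrite -(@integral_representative Omega u v (divergence theta) id oO mu bv vu _
  (test_field_tame tt).1 (d0 _ tt))//.
by apply: le_trans TVT; apply: ereal_sup_ubound; exists theta.
Qed.

End area_theory.

(** * Perturbation of an ROF solution *)

Section logistic.
Context {R : realType}.
Implicit Types (t s A B : R).

(** The derivative of this function is a polynomial in its value, which makes the first two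
    derivatives of the approximate step explicit and continuous, as the interpolation inequality
    requires. *)
Definition logistic t : R := (1 + expR (- t))^-1.

Lemma logistic_gt0 t : 0 < logistic t.
Proof. by rewrite invr_gt0 addr_gt0// expR_gt0. Qed.

Lemma logistic_lt1 t : logistic t < 1.
Proof. by rewrite invf_lt1 ?addr_gt0 ?expR_gt0// ltrDl expR_gt0. Qed.

Lemma is_derive_logistic t : is_derive t (1 : R) logistic (logistic t * (1 - logistic t)).
Proof.
have e0 : 1 + expR (- t) != 0 by rewrite gt_eqF// addr_gt0// expR_gt0.
have D1 := is_derive1_comp (is_derive_expR (- t)) (is_deriveN (is_derive_id t (1 : R))).
have D2 := is_deriveD (is_derive_cst (1 : R) t (1 : R)) D1.
have D3 := is_deriveV (f := fun t : R => 1 + expR (- t)) e0 D2.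
apply: (is_derive_eq D3).
rewrite /logistic -[_ *: _]/(_ * _); field.
exact: e0.
Qed.

Lemma logistic_nondecreasing : {homo logistic : s t / s <= t}.
Proof.
move=> s t st; rewrite /logistic lef_pV2 ?posrE ?addr_gt0 ?expR_gt0//.
by rewrite lerD2l ler_expR lerN2.
Qed.

Lemma logistic_ge t : 0 <= t -> 1 - (1 + t)^-1 <= logistic t.
Proof.
move=> t0; have e1 : 1 + t <= expR t := expR_ge1Dx t.
have p1 : 0 < 1 + t by lra.
have p2 : 0 < 1 + expR t by lra.
have -> : logistic t = 1 - (1 + expR t)^-1.
  by rewrite /logistic expRN; field; rewrite !gt_eqF ?expR_gt0 ?addr_gt0 ?expR_gt0.
by rewrite lerD2l lerN2 lef_pV2 ?posrE//; lra.
Qed.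

Lemma logistic_le t : 0 <= t -> logistic (- t) <= (1 + t)^-1.
Proof.
move=> t0; have e1 : 1 + t <= expR t := expR_ge1Dx t.
have p1 : 0 < 1 + t by lra.
have p2 : 0 < 1 + expR t by lra.
by rewrite /logistic opprK lef_pV2 ?posrE//; lra.
Qed.

(* The shift by n.+1 makes the limit 0, and not 1 / 2, at t = s. *)
Definition step s n t : R := logistic (n.+1%:R ^+ 2 * (t - s) - n.+1%:R).

Lemma step01 s n t : 0 <= step s n t <= 1.
Proof. by rewrite ltW ?logistic_gt0//= ltW// logistic_lt1. Qed.

Lemma is_derive_step s n t :
  is_derive t (1 : R) (step s n) (n.+1%:R ^+ 2 * (step s n t * (1 - step s n t))).
Proof.
have D0 : is_derive t (1 : R) (fun t => n.+1%:R ^+ 2 * (t - s) - n.+1%:R) (n.+1%:R ^+ 2 : R).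
  have D1 := is_deriveB (is_deriveZ (n.+1%:R ^+ 2 : R) (is_deriveB (is_derive_id t (1 : R))
    (is_derive_cst (s : R) t (1 : R)))) (is_derive_cst (n.+1%:R : R) t (1 : R)).
  by apply: (is_derive_eq D1); rewrite !subr0 /GRing.scale/= mulr1.
have D := @is_derive1_comp _ logistic (fun t => n.+1%:R ^+ 2 * (t - s) - n.+1%:R) t _ _
  (is_derive_logistic (n.+1%:R ^+ 2 * (t - s) - n.+1%:R)) D0.
by apply: (is_derive_eq D); rewrite mulrC.
Qed.

Lemma step_cvg s t : (fun n => step s n t) @ \oo --> ((s < t)%R%:R : R).
Proof.
have h0 : (fun n => (n.+1%:R : R)^-1) @ \oo --> (0 : R) by exact: cvg_harmonic.
have [st|ts] := ltP s t.
  apply/cvgrPdist_le => e e0.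
  have d0 : 0 < (t - s) / 2 by rewrite divr_gt0// subr_gt0.
  (* The second bound forces (n + 1) (t - s) >= 2, so that the quadratic slope outweighs the shift
     by n + 1. *)
  have e0' : 0 < Num.min e ((t - s) / 2) by rewrite lt_min e0.
  move/cvgrPdist_le : h0 => /(_ _ e0'); apply: filterS => n /=.
  have n0 : 0 < n.+1%:R :> R by [].
  rewrite sub0r normrN ger0_norm ?invr_ge0// le_min => /andP[ne nd].
  have /andP[_ S1] := step01 s n t.
  rewrite ger0_norm ?subr_ge0//.
  have nd' : 1 <= n.+1%:R * ((t - s) / 2) by rewrite -ler_pdivrMl// mulr1.
  have X : n.+1%:R <= n.+1%:R ^+ 2 * (t - s) - n.+1%:R :> R.
    have : n.+1%:R * 1 <= n.+1%:R * (n.+1%:R * ((t - s) / 2)) by rewrite ler_pM2l.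
    by move: (n.+1%:R) => N; rewrite expr2; lra.
  have L := logistic_nondecreasing X; have L2 := logistic_ge (ltW n0).
  have N1 : (1 + n.+1%:R)^-1 <= n.+1%:R^-1 :> R by rewrite lef_pV2 ?posrE ?addr_gt0// lerDr.
  by apply: le_trans (le_trans N1 ne); rewrite lerBlDr -lerBlDl; exact: le_trans L2 L.
apply/cvgrPdist_le => e e0.
move/cvgrPdist_le : h0 => /(_ _ e0); apply: filterS => n /=.
have n0 : 0 < n.+1%:R :> R by [].
rewrite !sub0r !normrN ger0_norm ?invr_ge0// => ne.
have /andP[S0 _] := step01 s n t; rewrite ger0_norm//.
have X : n.+1%:R ^+ 2 * (t - s) - n.+1%:R <= - n.+1%:R :> R.
  have : n.+1%:R ^+ 2 * (t - s) <= 0 by rewrite mulr_ge0_le0 ?sqr_ge0// subr_le0.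
  by move: (n.+1%:R) => N; lra.
have L := logistic_nondecreasing X; have L2 := logistic_le (ltW n0).
have N1 : (1 + n.+1%:R)^-1 <= n.+1%:R^-1 :> R by rewrite lef_pV2 ?posrE ?addr_gt0// lerDr.
exact: le_trans (le_trans L (le_trans L2 N1)) ne.
Qed.

End logistic.

Lemma TV_perturbation_arith {R : realFieldType} (T A g P a b1 b2 d e : R) :
  b1 + b2 <= T -> b1 = A * a -> d = b2 + g * e -> g * e <= g * P ->
  d <= T - A * a + g * P.
Proof. by move=> h b1E -> ?; lra. Qed.

(** [A] is the size of the perturbation. The comparison of energies is of first order in [A] except
    for the term with [Z], so division by [A] leaves the error [A * (mu / 2) * a]. *)
Lemma ROF_perturbation_arith {R : realFieldType} (mu A T T' W X Y Z c P a : R) :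
  0 < mu -> 0 < A -> Z <= a -> T' <= T - A * W + A * c * P ->
  T + mu / 2 * X <= T' + mu / 2 * (X + 2 * A * Y + A ^+ 2 * Z) ->
  W <= c * P + mu * Y + A * (mu / 2) * a.
Proof.
move=> mu0 A0 Za hT h; rewrite -(ler_pM2l A0).
have h1 : (mu / 2 * A ^+ 2) * Z <= (mu / 2 * A ^+ 2) * a.
  by rewrite ler_wpM2l// mulr_ge0 ?sqr_ge0// divr_ge0// ltW.
lra.
Qed.

Section chan_vese.
Context {R : realType}.
Variables (Omega : set (R * R)) (f : R * R -> R).
Hypotheses (oO : open Omega) (bO : bounded_set Omega).
Hypotheses (mf : leb_measurable_fun Omega f) (f01 : unit_valued Omega f).
Local Notation lp := (leb_plane R).
Local Notation I h := (Rintegral (@area R) Omega h).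

Let mO : measurable (Omega : set lp). Proof. exact: open_leb_measurable. Qed.

Let finO : (area (Omega : set lp) < +oo)%E. Proof. exact: bounded_area. Qed.

Lemma bounded_area_integrable (h : R * R -> R) M (A : set (R * R)) :
  measurable (A : set lp) -> A `<=` Omega ->
  measurable_fun (A : set lp) (h : lp -> R) -> (forall x, A x -> `|h x| <= M) ->
  (@area R).-integrable (A : set lp) (EFin \o h).
Proof.
move=> mA AO mh hM; apply: measurable_bounded_integrable => //.
  by apply: le_lt_trans finO; apply: le_measure; rewrite ?inE.
exists M; split; first exact: num_real.
by move=> t Mt x Ax /=; rewrite (le_trans (hM x Ax))// ltW.
Qed.

Lemma divergence_bounded phi : test_field Omega phi -> exists M, forall x, `|divergence phi x| <= M.
Proof.
move=> /test_field_tame[_ [M [B hMB]]]; exists (`|M|) => x.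
rewrite (le_trans (hMB x))// indicE; case: (_ \in _); rewrite ?mulr1 ?mulr0 ?ler_norm//.
Qed.

Lemma divergence_measurable phi : test_field Omega phi ->
  measurable_fun (Omega : set lp) (divergence phi : lp -> R).
Proof. by move=> /test_field_tame[b _]; apply: measurable_funTS; exact: borel_leb_fun. Qed.

(** The zero field is admissible. This excludes the value -oo, so that a finite upper bound makes
    the total variation a real number. *)
Lemma TV_ge0 u : (0 <= TV Omega u)%E.
Proof.
have C0 : C1 (fun _ : R * R => 0 : R).
  split; [by move=> x; exact: cvg_cst|by []|by []|..].
  - by under eq_fun do rewrite derive_cst; move=> x; exact: cvg_cst.
  - by under eq_fun do rewrite derive_cst; move=> x; exact: cvg_cst.
have t0 : test_field Omega (fun _ => (0, 0)).
  apply: (@compact_test_field _ _ _ set0) => //.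
  - exact: C1_field_pair.
  - exact: compact0.
  - by move=> x; rewrite eqxx.
  - by move=> x; rewrite /eucl_norm/= expr0n/= addr0 sqrtr0.
apply: ereal_sup_ubound; exists (fun _ => (0, 0)) => //.
apply: integral0_eq => x _.
by rewrite (divergence_pair x C0 C0) !derive_cst addr0 mulr0.
Qed.

Lemma product_integrable (v w : R * R -> R) M M' :
  measurable_fun (Omega : set lp) (v : lp -> R) -> (forall x, Omega x -> `|v x| <= M) ->
  measurable_fun (Omega : set lp) (w : lp -> R) -> (forall x, Omega x -> `|w x| <= M') ->
  (@area R).-integrable (Omega : set lp) (EFin \o (fun x => v x * w x)).
Proof.
move=> mv vM mw wM.
apply: (bounded_area_integrable (M := M * M') mO (@subset_refl _ Omega) (measurable_funM mv mw)).
by move=> x Ox; rewrite normrM ler_pM ?vM ?wM.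
Qed.

Lemma test_integrable u phi M : leb_measurable_fun Omega u -> (forall x, Omega x -> `|u x| <= M) ->
  test_field Omega phi ->
  (@area R).-integrable (Omega : set lp) (EFin \o (fun x => u x * divergence phi x)).
Proof.
move=> mu uM tphi; have [M' hM'] := divergence_bounded tphi.
exact: (product_integrable mu uM (divergence_measurable tphi) (fun x _ => hM' x)).
Qed.

Lemma TV_test u phi M : leb_measurable_fun Omega u -> (forall x, Omega x -> `|u x| <= M) ->
  test_field Omega phi -> ((I (fun x => u x * divergence phi x))%:E <= TV Omega u)%E.
Proof.
move=> mu uM tphi; apply: ereal_sup_ubound; exists phi; first exact: tphi.
rewrite /Rintegral fineK; first by [].
exact: integrable_fin_num (test_integrable mu uM tphi).
Qed.

Lemma TV_le u M (T : \bar R) : leb_measurable_fun Omega u -> (forall x, Omega x -> `|u x| <= M) ->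
  (forall phi, test_field Omega phi -> ((I (fun x => u x * divergence phi x))%:E <= T)%E) ->
  (TV Omega u <= T)%E.
Proof.
move=> mu uM uT; apply: ge_ereal_sup => _ [phi tphi <-].
have := uT _ tphi; rewrite /Rintegral fineK; first by [].
exact: integrable_fin_num (test_integrable mu uM tphi).
Qed.

Variables (mu : R) (u : R * R -> R).
Hypotheses (mu0 : 0 < mu) (uROF : ROF_solution Omega f mu u).

Let mu_u : leb_measurable_fun Omega u. Proof. by have [[]] := uROF. Qed.
Let u01 : unit_valued Omega u. Proof. by have [[]] := uROF. Qed.

Lemma unit_valued_norm w : unit_valued Omega w -> forall x, Omega x -> `|w x| <= 1.
Proof. by move=> w01 x Ox; exact: unit_norm (w01 x Ox). Qed.

Lemma BV_TV_fin w : BV Omega w -> exists T : R, TV Omega w = T%:E.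
Proof.
move=> [mw w01 h]; exists (fine (TV Omega w)); rewrite fineK//.
rewrite ge0_fin_numE ?TV_ge0//; apply: le_lt_trans h.
by rewrite leeDr// integral_ge0.
Qed.

(* Obtained by comparing u with u - eta * G + eta * c * \1_Sigma for
   eta = (n.+1 ^ 2)^-1, the largest slope of [step s n] being at most n.+1 ^ 2. *)
Lemma ROF_perturbation (Sigma : set (R * R)) (P : R) s n phi :
  measurable_part Omega Sigma -> (Per Sigma Omega <= P%:E)%E -> test_field Omega phi ->
  let G x := step s n (u x) - step s n 0 in
  let c := step s n 1 - step s n 0 in
  I (fun x => G x * divergence phi x) <=
    c * P + mu * I (fun x => (u x - f x) * (c * \1_Sigma x - G x))
    + (n.+1%:R ^+ 2)^-1 * (mu / 2) * fine (area (Omega : set lp)).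
Proof.
move=> [mS SO] SP tphi.
pose G x := step s n (u x) - step s n 0; pose c := step s n 1 - step s n 0.
change (is_true (I (fun x => G x * divergence phi x) <=
    c * P + mu * I (fun x => (u x - f x) * (c * \1_Sigma x - G x))
    + (n.+1%:R ^+ 2)^-1 * (mu / 2) * fine (area (Omega : set lp)))).
pose A : R := n.+1%:R ^+ 2.
have A0 : 0 < A by rewrite exprn_gt0.
pose g t := A^-1 * (step s n t - step s n 0).
pose k t := step s n t * (1 - step s n t).
pose k' t := A * k t * (1 - 2 * step s n t).
have dg t : is_derive t (1 : R) g (k t).
  have D := is_deriveZ A^-1 (is_deriveB (is_derive_step s n t)
    (is_derive_cst (step s n 0) t (1 : R))).
  by apply: (is_derive_eq D); rewrite subr0 /GRing.scale/= /k /A mulKf// gt_eqF.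
have dk t : is_derive t (1 : R) k (k' t).
  have Ds := is_derive_step s n t.
  have D := is_deriveM Ds (is_deriveB (is_derive_cst (1 : R) t (1 : R)) Ds).
  apply: (is_derive_eq D); rewrite -[(cst 1 - step s n) t]/(1 - step s n t).
  by rewrite /GRing.scale/= /k' /k /A; ring.
have cs : continuous (step s n).
  exact: is_derive_continuous (is_derive_step s n).
have ck' : continuous k'.
  move=> t; apply: cvgM; [apply: cvgM; [exact: cvg_cst|apply: cvgM; [exact: cs|]]|];
    apply: cvgB; try exact: cvg_cst; try exact: cs.
  by apply: cvgM; [exact: cvg_cst|exact: cs].
have k01 t : 0 <= k t <= 1.
  have := step01 s n t; rewrite /k; move: (step s n t) => y /andP[y0 y1].
  by rewrite mulr_ge0 ?subr_ge0//= mulr_ile1 ?subr_ge0//; lra.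
have gmon a b : a <= b -> 0 <= g b - g a <= b - a.
  move=> ab; have [+ _] := contraction_lipschitz dg k01 b a.
  have gab : g a <= g b.
    rewrite /g ler_pM2l ?invr_gt0// lerB// logistic_nondecreasing// lerB// ler_pM2l// lerB//.
  by rewrite !ger0_norm ?subr_ge0// gab => ->.
have g0 : g 0 = 0 by rewrite /g subrr mulr0.
have [T TE] := BV_TV_fin uROF.1.
have gG x : g (u x) = A^-1 * G x by [].
have gc : g 1 = A^-1 * c by [].
have c01 : 0 <= c <= 1.
  have /andP[h1 _] := step01 s n 0; have /andP[_ h2] := step01 s n 1.
  rewrite /c subr_ge0 logistic_nondecreasing ?lerB ?ler_pM2l//=; lra.
have G01 x : Omega x -> 0 <= G x <= 1.
  move=> /u01/andP[ux0 ux1]; have /andP[h1 _] := step01 s n 0; have /andP[_ h2] := step01 s n (u x).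
  rewrite /G subr_ge0 logistic_nondecreasing ?lerB ?ler_pM2l ?lerB//=; lra.
pose v x := u x - g (u x) + g 1 * \1_Sigma x.
have mstep : measurable_fun setT (step s n) by exact: continuous_measurable_fun.
have mG : measurable_fun (Omega : set lp) (G : lp -> R).
  by apply: measurable_funB; [exact: (measurableT_comp mstep)|exact: measurable_cst].
have mg : measurable_fun (Omega : set lp) ((fun x => g (u x)) : lp -> R).
  by apply: measurable_funM; [exact: measurable_cst|exact: mG].
have mug : measurable_fun (Omega : set lp) ((fun x => u x - g (u x)) : lp -> R).
  exact: measurable_funB.
have m1 : measurable_fun (Omega : set lp) ((fun x => \1_Sigma x) : lp -> R).
  exact: measurable_indic.
have mv : leb_measurable_fun Omega v.
  by apply: (measurable_funD mug); apply: (measurable_funM _ m1); exact: measurable_cst.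
(* The function [t - g t] is nondecreasing, so [u - g u] lies between 0 and [1 - g 1]; this leaves
   exactly the room for [g 1] on [Sigma]. *)
have v01 : unit_valued Omega v.
  move=> x Ox; have /andP[ux0 ux1] := u01 Ox.
  have := gmon _ _ ux0; have := gmon _ _ ux1; rewrite g0 /v indicE.
  by case: (_ \in _) => /=; rewrite ?mulr1 ?mulr0; lra.
have i01 x : Omega x -> `|\1_Sigma x| <= 1 :> R.
  by move=> _; rewrite indicE; case: (_ \in _); rewrite ?normr1 ?normr0.
have gu01 x : Omega x -> `|g (u x)| <= 1.
  move=> Ox; have /andP[ux0 ux1] := u01 Ox; have := gmon _ _ ux0; rewrite g0 => h.
  by apply: unit_norm; lra.
have ug01 x : Omega x -> `|u x - g (u x)| <= 1.
  move=> Ox; have /andP[ux0 ux1] := u01 Ox; have := gmon _ _ ux0; rewrite g0 => h.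
  by apply: unit_norm; lra.
have g10 : 0 <= g 1 by have := gmon _ _ (@ler01 R); rewrite g0; lra.
have vdef x : v x = u x - g (u x) + g 1 * \1_Sigma x by [].
have TVI psi : test_field Omega psi ->
    I (fun x => g (u x) * divergence phi x) + I (fun x => (u x - g (u x)) * divergence psi x) <= T.
  move=> tpsi; apply: (TV_interpolation oO bO mu_u u01 _ dg dk ck' k01 tphi tpsi).
  by rewrite TE lexx.
clear dg dk ck' k01 gmon cs.
clearbody v G c g k k'.
(* [phi] stays fixed while [psi] runs over all test fields. This bounds the variation of the
   competitor [v], and the finiteness of the bound puts [v] in [BV]. *)
have TVv : (TV Omega v <= (T - A^-1 * I (fun x => G x * divergence phi x) + g 1 * P)%:E)%E.
  apply: (TV_le mv (unit_valued_norm v01)) => psi tpsi.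
  have h0 := TVI _ tpsi.
  have iG := test_integrable mG (fun x Ox => unit_norm (G01 x Ox)) tphi.
  have i1 := test_integrable m1 i01 tpsi.
  have i2 := test_integrable mug ug01 tpsi.
  have E1 : I (fun x => g (u x) * divergence phi x) = A^-1 * I (fun x => G x * divergence phi x).
    rewrite -(RintegralZl _ mO iG); apply: eq_Rintegral => x _.
    by rewrite gG mulrA.
  have E2 : I (fun x => v x * divergence psi x) = I (fun x => (u x - g (u x)) * divergence psi x) +
      g 1 * I (fun x => \1_Sigma x * divergence psi x).
    rewrite -(RintegralZl _ mO i1) -(RintegralD mO i2); last exact: (integrableZl mO (g 1) i1).
    by apply: eq_Rintegral => x _; rewrite vdef mulrDl mulrA.
  have := le_trans (TV_test m1 i01 tpsi) SP; rewrite !lee_fin => h1.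
  have h3 := ler_wpM2l g10 h1.
  exact: TV_perturbation_arith h0 E1 E2 h3.
have BVv : BV Omega v.
  split => //; rewrite lte_add_pinfty//; last exact: le_lt_trans TVv (ltry _).
  have iv := @bounded_area_integrable v 1 Omega mO (@subset_refl _ Omega) mv (unit_valued_norm v01).
  by move/integrableP : iv => [].
have [T' TE'] := BV_TV_fin BVv.
have ROFv := uROF.2 v BVv.
pose q x := c * \1_Sigma x - G x.
have vE x : v x - f x = (u x - f x) + A^-1 * q x by rewrite vdef gG gc /q; ring.
have mq : measurable_fun (Omega : set lp) (q : lp -> R).
  by apply: (measurable_funB _ mG); apply: (measurable_funM _ m1); exact: measurable_cst.
have q1 x : Omega x -> `|q x| <= 1.
  move=> Ox; have := G01 x Ox; rewrite /q indicE ler_norml.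
  by case: (_ \in _) => /=; rewrite ?mulr1 ?mulr0; lra.
change (is_true (I (fun x => G x * divergence phi x) <=
    c * P + mu * I (fun x => (u x - f x) * q x) + A^-1 * (mu / 2) * fine (area (Omega : set lp)))).
clearbody q A.
have muf : measurable_fun (Omega : set lp) ((fun x => u x - f x) : lp -> R).
  exact: measurable_funB.
have uf1 x : Omega x -> `|u x - f x| <= 1.
  by move=> Ox; apply: unit_subr_norm; [exact: u01|exact: f01].
have mvf : measurable_fun (Omega : set lp) ((fun x => v x - f x) : lp -> R).
  exact: measurable_funB.
have vf1 x : Omega x -> `|v x - f x| <= 1.
  by move=> Ox; apply: unit_subr_norm; [exact: v01|exact: f01].
have iuf2 := product_integrable muf uf1 muf uf1.
have iufq := product_integrable muf uf1 mq q1.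
have iqq := product_integrable mq q1 mq q1.
have sqE (w : R * R -> R) : (@area R).-integrable (Omega : set lp) (EFin \o (fun x => w x * w x)) ->
    (\int[@area R]_(x in Omega) ((w x) ^+ 2)%:E)%E = (I (fun x => w x * w x))%:E.
  by move=> iw; rewrite /Rintegral fineK; [exact: eq_integral|exact: integrable_fin_num iw].
move: ROFv; rewrite /ROF TE TE' (sqE _ iuf2).
rewrite (sqE (fun x => v x - f x) (product_integrable mvf vf1 mvf vf1)).
rewrite -!EFinM -!EFinD lee_fin.
have -> : I (fun x => (v x - f x) * (v x - f x)) = I (fun x => (u x - f x) * (u x - f x)) +
    2 * A^-1 * I (fun x => (u x - f x) * q x) + A^-1 ^+ 2 * I (fun x => q x * q x).
  have j1 := integrableZl mO (2 * A^-1) iufq; have j2 := integrableZl mO (A^-1 ^+ 2) iqq.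
  rewrite -(RintegralZl _ mO iufq) -(RintegralZl _ mO iqq) -(RintegralD mO iuf2 j1).
  rewrite -(RintegralD mO (integrableD mO iuf2 j1) j2).
  by apply: eq_Rintegral => x _; rewrite vE; ring.
move: TVv; rewrite TE' lee_fin => TVv.
have qq : I (fun x => q x * q x) <= fine (area (Omega : set lp)).
  have -> : fine (area (Omega : set lp)) = I (fun _ => 1) by rewrite Rintegral_cst ?mul1r.
  apply: (le_Rintegral mO iqq).
    by apply: (@bounded_area_integrable (cst 1) 1) => // x _; rewrite normr1.
  by move=> x Ox; rewrite -expr2 -[X in X <= _]ger0_norm ?sqr_ge0// normrX expr_le1// q1.
move=> E; rewrite gc in TVv.
have Ai : 0 < A^-1 by rewrite invr_gt0.
exact: (ROF_perturbation_arith mu0 Ai qq TVv E).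
Qed.

End chan_vese.

(** * Level sets of an ROF solution *)

Section level_sets.
Context {R : realType}.
Variables (Omega : set (R * R)) (f : R * R -> R).
Hypotheses (oO : open Omega) (bO : bounded_set Omega).
Hypotheses (mf : leb_measurable_fun Omega f) (f01 : unit_valued Omega f).
Local Notation lp := (leb_plane R).
Local Notation I h := (Rintegral (@area R) Omega h).

Let mO : measurable (Omega : set lp). Proof. exact: open_leb_measurable. Qed.

Lemma integral_part (Sigma : set (R * R)) (F : R * R -> \bar R) : Sigma `<=` Omega ->
  (\int[@area R]_(x in Sigma) F x = \int[@area R]_(x in Omega) ((\1_Sigma x)%:E * F x))%E.
Proof.
move=> SO; rewrite integral_mkcond [RHS]integral_mkcond; apply: eq_integral => x _.
rewrite !patchE indicE; have [xS|xS] := boolP (x \in Sigma).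
  by rewrite mem_set ?mul1e//; apply: SO; rewrite inE in xS.
by case: ifP => // _; rewrite mul0e.
Qed.

Lemma const_integrable (A : set (R * R)) (c : R) : measurable_part Omega A ->
  (@area R).-integrable (A : set lp) (EFin \o cst c).
Proof.
move=> [mA AO]; apply: (bounded_area_integrable (M := `|c|) oO bO mA AO) => // x _.
Qed.

Lemma measurable_part_measurable_fun (A : set (R * R)) (h : R * R -> R) : measurable_part Omega A ->
  leb_measurable_fun Omega h -> measurable_fun (A : set lp) (h : lp -> R).
Proof. by move=> [mA AO] mh; exact: (measurable_funS mO AO). Qed.

(** Replacing the mean by [m] adds the square of their difference times the area, because the
    deviation of [f] from its mean integrates to zero. *)
Lemma mean_minimizes (A : set (R * R)) (m : R) : measurable_part Omega A ->
  (\int[@area R]_(x in A) ((mean f A - f x) ^+ 2)%:E <=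
   \int[@area R]_(x in A) ((m - f x) ^+ 2)%:E)%E.
Proof.
move=> pA; have [mA AO] := pA.
have mfA := measurable_part_measurable_fun pA mf.
have mcf (c : R) : measurable_fun (A : set lp) ((fun x => c - f x) : lp -> R).
  by apply: measurable_funB => //; exact: measurable_cst.
have mcf2 (c : R) : measurable_fun (A : set lp) ((fun x => (c - f x) ^+ 2) : lp -> R).
  exact: measurable_funX.
have iq (c : R) : (@area R).-integrable (A : set lp) (EFin \o (fun x => (c - f x) ^+ 2)).
  apply: (bounded_area_integrable (M := (`|c| + 1) ^+ 2) oO bO mA AO (mcf2 c)) => x Ax.
  rewrite normrX lerXn2r ?nnegrE ?addr_ge0// (le_trans (ler_normB _ _))// lerD2l.
  exact: unit_norm (f01 (AO _ Ax)).
(* On a null set both integrals vanish, whatever the default value of [mean]. *)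
have [Apos|A0] := boolP (0 < area (A : set lp))%E; last first.
  have A00 : area (A : set lp) = 0%E by apply/eqP; rewrite -measure_le0 leNgt.
  have mE (c : R) : measurable_fun (A : set lp) (fun x => ((c - f x) ^+ 2)%:E).
    by apply/measurable_EFinP; exact: mcf2.
  by rewrite (null_set_integral mA (mE (mean f A)) A00) (null_set_integral mA (mE m) A00).
have finA : area (A : set lp) \is a fin_num.
  rewrite ge0_fin_numE//; apply: le_lt_trans (bounded_area oO bO).
  by apply: le_measure; rewrite ?inE.
pose a := fine (area (A : set lp)).
have a0 : 0 < a by rewrite fine_gt0// Apos ltey_eq finA.
pose F := Rintegral (@area R) (A : set lp) f.
pose M := mean f A.
have ME : M * a = F.
  by rewrite /M /mean Apos -/a -/F mulrAC mulVf ?mul1r// gt_eqF.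
have if_ : (@area R).-integrable (A : set lp) (EFin \o f).
  apply: (bounded_area_integrable (M := 1) oO bO mA AO mfA) => x Ax.
  exact: unit_norm (f01 (AO _ Ax)).
have i1 := const_integrable 1 pA.
have I1 : Rintegral (@area R) (A : set lp) (cst 1) = a by rewrite Rintegral_cst// mul1r.
have E : Rintegral (@area R) (A : set lp) (fun x => (m - f x) ^+ 2) =
   Rintegral (@area R) (A : set lp) (fun x => (M - f x) ^+ 2) + (m - M) ^+ 2 * a.
  have j1 := integrableZl mA (2 * (M - m)) if_.
  have j2 := integrableZl mA (m ^+ 2 - M ^+ 2) i1.
  transitivity (Rintegral (@area R) (A : set lp) (fun x => (M - f x) ^+ 2) +
    (2 * (M - m)) * F + (m ^+ 2 - M ^+ 2) * a); last by rewrite -ME; ring.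
  rewrite -I1 /F -(RintegralZl _ mA if_) -(RintegralZl _ mA i1).
  rewrite -(RintegralD mA (iq M) j1) -(RintegralD mA (integrableD mA (iq M) j1) j2).
  by apply: eq_Rintegral => x _ /=; ring.
have fK (c : R) : (\int[@area R]_(x in A) ((c - f x) ^+ 2)%:E)%E =
    (Rintegral (@area R) (A : set lp) (fun x => (c - f x) ^+ 2))%:E.
  by rewrite /Rintegral fineK//; exact: integrable_fin_num (iq c).
by rewrite !fK lee_fin -/M E lerDl mulr_ge0 ?sqr_ge0// ltW.
Qed.

(** A single integral over [Omega], affine in the indicator of [Sigma], allows two sets to be
    compared pointwise. *)
Lemma fidelity (Sigma : set (R * R)) (m0 m1 : R) : measurable_part Omega Sigma ->
  (\int[@area R]_(x in Sigma) ((m1 - f x) ^+ 2)%:E +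
    \int[@area R]_(x in Omega `\` Sigma) ((m0 - f x) ^+ 2)%:E)%E =
  (I (fun x => (m0 - f x) ^+ 2 + \1_Sigma x * ((m1 - f x) ^+ 2 - (m0 - f x) ^+ 2)))%:E /\
  (@area R).-integrable (Omega : set lp) (EFin \o
    (fun x => (m0 - f x) ^+ 2 + \1_Sigma x * ((m1 - f x) ^+ 2 - (m0 - f x) ^+ 2))).
Proof.
move=> [mS SO].
have mcf2 (c : R) : measurable_fun (Omega : set lp) ((fun x => (c - f x) ^+ 2) : lp -> R).
  by apply: measurable_funX; apply: measurable_funB => //; exact: measurable_cst.
have bd (c : R) x : Omega x -> `|(c - f x) ^+ 2| <= (`|c| + 1) ^+ 2.
  move=> Ox; rewrite normrX lerXn2r ?nnegrE ?addr_ge0// (le_trans (ler_normB _ _))// lerD2l.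
  exact: unit_norm (f01 Ox).
have iq (A : set (R * R)) (c : R) : measurable (A : set lp) ->
    (@area R).-integrable (Omega : set lp) (EFin \o (fun x => \1_A x * (c - f x) ^+ 2)).
  move=> mA; apply: (product_integrable oO bO _ _ (mcf2 c) (bd c) (M := 1)).
    exact: measurable_indic.
  by move=> x _; rewrite indicE; case: (_ \in _); rewrite ?normr1 ?normr0.
have mD : measurable (Omega `\` Sigma : set lp) by exact: measurableD.
have E (A : set (R * R)) (c : R) : measurable (A : set lp) -> A `<=` Omega ->
    (\int[@area R]_(x in A) ((c - f x) ^+ 2)%:E)%E = (I (fun x => \1_A x * (c - f x) ^+ 2))%:E.
  move=> mA AO; rewrite (integral_part _ AO) /Rintegral fineK//.
  exact: integrable_fin_num (iq A c mA).
have eqJ x : Omega x -> \1_Sigma x * (m1 - f x) ^+ 2 + \1_(Omega `\` Sigma) x * (m0 - f x) ^+ 2 =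
    (m0 - f x) ^+ 2 + \1_Sigma x * ((m1 - f x) ^+ 2 - (m0 - f x) ^+ 2).
  move=> Ox; rewrite !indicE in_setD (mem_set Ox)/=.
  by case: (_ \in _) => /=; ring.
split.
  rewrite (E _ _ mS SO) (E _ _ mD); last exact: subDsetl.
  rewrite -EFinD -(RintegralD mO (iq _ m1 mS) (iq _ m0 mD)); congr EFin.
  by apply: eq_Rintegral => x /set_mem Ox; exact: eqJ.
move: (integrableD mO (iq _ m1 mS) (iq _ m0 mD)); apply: (eq_integrable mO).
by move=> x /set_mem Ox /=; rewrite -EFinD eqJ.
Qed.

Variables (mu : R) (u : R * R -> R).
Hypotheses (mu0 : 0 < mu) (uROF : ROF_solution Omega f mu u).
Variable s : R.
Hypothesis s01 : 0 < s < 1.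

Local Notation S := [set x | Omega x /\ s < u x].

Let mu_u : leb_measurable_fun Omega u. Proof. by have [[]] := uROF. Qed.
Let u01 : unit_valued Omega u. Proof. by have [[]] := uROF. Qed.

Lemma level_set_part : measurable_part Omega S.
Proof.
split; last by move=> x [].
have -> : S = Omega `&` u @^-1` `]s, +oo[.
  by apply/seteqP; split => x /=; rewrite in_itv/= andbT.
exact: mu_u.
Qed.

(** The limit in [n] is taken for a fixed [phi], with constants on [Omega] as integrable majorants.
    Taking the supremum over [phi] only afterwards amounts to the lower semicontinuity of the total
    variation. *)
Lemma level_set_test (Sigma : set (R * R)) (P : R) phi :
  measurable_part Omega Sigma -> (Per Sigma Omega <= P%:E)%E -> test_field Omega phi ->
  I (fun x => \1_S x * divergence phi x) <=
    P + mu * I (fun x => (u x - f x) * (\1_Sigma x - \1_S x)).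
Proof.
move=> pS SP tphi; have [mSg SO] := pS; have [mSl _] := level_set_part.
pose c n := step s n 1 - step s n 0.
pose G n x := step s n (u x) - step s n 0.
pose a0 := fine (area (Omega : set lp)).
have H n : I (fun x => G n x * divergence phi x) <=
    c n * P + mu * I (fun x => (u x - f x) * (c n * \1_Sigma x - G n x))
    + (n.+1%:R ^+ 2)^-1 * (mu / 2) * a0.
  exact: (ROF_perturbation oO bO mf f01 mu0 uROF s n pS SP tphi).
have [/andP[s0 s1]] := s01.
(* As 0 < s < 1, the values of the approximate steps at 0 and at 1 tend to 0 and to 1, so the
   normalizing constants [c n] tend to 1. *)
have s0F : (s < 0) = false by apply/negbTE; rewrite -leNgt ltW.
have stepB t : (fun n => step s n t - step s n 0) @ \oo --> ((s < t)%R%:R : R).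
  have h : (fun n => step s n t - step s n 0) @ \oo --> ((s < t)%R%:R - (s < 0)%R%:R : R).
    by apply: cvgB; exact: step_cvg.
  by rewrite s0F subr0 in h.
have ccvg : (fun n => c n) @ \oo --> (1 : R) by have := stepB 1; rewrite s1.
have Gcvg x : Omega x -> (fun n => G n x) @ \oo --> (\1_S x : R).
  move=> Ox; have SE : \1_S x = (s < u x)%R%:R :> R.
    rewrite indicE; have [su|su] := boolP (s < u x); first by rewrite mem_set.
    by rewrite memNset//= => -[_]; exact/negP.
  by rewrite SE; exact: stepB.
have cs n : continuous (step s n).
  exact: is_derive_continuous (is_derive_step s n).
have mstep n : measurable_fun setT (step s n) by exact: continuous_measurable_fun (cs n).
have mG n : measurable_fun (Omega : set lp) (G n : lp -> R).
  apply: measurable_funB; last exact: measurable_cst.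
  exact: (measurableT_comp (mstep n) mu_u).
have G1 n x : `|G n x| <= 1.
  by apply: unit_subr_norm; exact: step01.
have c1 n : `|c n| <= 1.
  by apply: unit_subr_norm; exact: step01.
have [M hM] := divergence_bounded tphi.
have mdiv := divergence_measurable tphi.
have m1 (A : set (R * R)) : measurable (A : set lp) ->
    measurable_fun (Omega : set lp) ((fun x => \1_A x) : lp -> R).
  by move=> mA; exact: measurable_indic.
have iM (K : R) : (@area R).-integrable (Omega : set lp) (EFin \o cst K).
  by apply: const_integrable; split.
have L1 : (fun n => I (fun x => G n x * divergence phi x)) @ \oo -->
    I (fun x => \1_S x * divergence phi x).
  apply: (Rdominated_cvg mO _ _ _ (iM M)).
  - by move=> n; exact: measurable_funM (mG n) mdiv.
  - exact: measurable_funM (m1 _ mSl) mdiv.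
  - apply: aeW => x Ox.
    by apply: (@cvgM R _ \oo); [exact: Gcvg|exact: cvg_cst].
  - by move=> n x _; rewrite normrM -[leRHS]mul1r ler_pM//; exact: hM.
have muf : measurable_fun (Omega : set lp) ((fun x => u x - f x) : lp -> R).
  exact: measurable_funB mu_u mf.
have uf1 x : Omega x -> `|u x - f x| <= 1.
  by move=> Ox; apply: unit_subr_norm; [exact: u01|exact: f01].
have L2 : (fun n => I (fun x => (u x - f x) * (c n * \1_Sigma x - G n x))) @ \oo -->
    I (fun x => (u x - f x) * (\1_Sigma x - \1_S x)).
  apply: (Rdominated_cvg mO _ _ _ (iM 2)).
  - move=> n; apply: (measurable_funM muf); apply: (measurable_funB _ (mG n)).
    by apply: (measurable_funM _ (m1 _ mSg)); exact: measurable_cst.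
  - by apply: (measurable_funM muf); exact: measurable_funB (m1 _ mSg) (m1 _ mSl).
  - apply: aeW => x Ox; apply: (@cvgM R _ \oo); first exact: cvg_cst.
    apply: (@cvgB _ _ _ \oo); last exact: Gcvg.
    rewrite -[X in _ --> X](mul1r (\1_Sigma x : R)).
    by apply: (@cvgM R _ \oo); [exact: ccvg|exact: cvg_cst].
  - move=> n x Ox; rewrite normrM -[leRHS]mul1r ler_pM ?uf1//.
    rewrite (le_trans (ler_normB _ _))// (_ : 2 = 1 + 1)// lerD// normrM -[leRHS]mul1r ler_pM//.
    by rewrite indicE; case: (_ \in _); rewrite ?normr1 ?normr0.
have L3 : (fun n => (n.+1%:R ^+ 2)^-1 * (mu / 2) * a0) @ \oo --> (0 : R).
  have h0 : (fun n => (n.+1%:R : R)^-1) @ \oo --> (0 : R) by exact: cvg_harmonic.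
  rewrite (_ : (fun n => _) = fun n => (n.+1%:R : R)^-1 * ((n.+1%:R : R)^-1 * (mu / 2 * a0))).
    rewrite -[X in _ --> X](mul0r (0 * (mu / 2 * a0))).
    apply: (@cvgM R _ \oo); first exact: h0.
    by apply: (@cvgM R _ \oo); [exact: h0|exact: cvg_cst].
  by apply/funext => n; rewrite expr2 invfM !mulrA.
have R1 : (fun n => c n * P + mu * I (fun x => (u x - f x) * (c n * \1_Sigma x - G n x))
    + (n.+1%:R ^+ 2)^-1 * (mu / 2) * a0) @ \oo -->
    1 * P + mu * I (fun x => (u x - f x) * (\1_Sigma x - \1_S x)) + 0.
  apply: (@cvgD _ _ _ \oo); last exact: L3.
  apply: (@cvgD _ _ _ \oo).
    by apply: (@cvgM R _ \oo); [exact: ccvg|exact: cvg_cst].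
  by apply: (@cvgM R _ \oo); [exact: cvg_cst|exact: L2].
rewrite mul1r addr0 in R1.
by apply: (ler_cvg_to L1 R1); apply: nearW => n; exact: H.
Qed.

End level_sets.

(** * Minimality for the Chan-Vese functional *)

Section minimality.
Context {R : realType}.
Variables (Omega : set (R * R)) (f : R * R -> R).
Hypotheses (oO : open Omega) (bO : bounded_set Omega).
Hypotheses (mf : leb_measurable_fun Omega f) (f01 : unit_valued Omega f).
Variables (mu : R) (u : R * R -> R).
Hypotheses (mu0 : 0 < mu) (uROF : ROF_solution Omega f mu u).
Variables (m0 m1 : R).
Hypotheses (m0_gt0 : 0 < m0) (m01 : m0 < m1) (m1_le1 : m1 <= 1).
Local Notation lp := (leb_plane R).
Local Notation I h := (Rintegral (@area R) Omega h).
Local Notation s := ((m1 + m0) / 2).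
Local Notation lambda := (mu / (2 * (m1 - m0))).
Local Notation S := [set x | Omega x /\ s < u x].

Let s01 : 0 < s < 1.
Proof.
have m1_gt0 := lt_trans m0_gt0 m01; have m0_lt1 := lt_le_trans m01 m1_le1.
by rewrite divr_gt0 ?addr_gt0//= ltr_pdivrMr// mul1r ler_ltD.
Qed.

Let lambda0 : 0 < lambda.
Proof. by rewrite divr_gt0// mulr_gt0// subr_gt0. Qed.

(** The value of [lambda] is chosen so that [lambda] times (m1 - f1)^2 - (m0 - f1)^2 equals mu (s -
    f1). The difference of the two sides is then mu (s - u1) (i1 - i2), and its two last factors
    have the same sign because [i2] is 1 exactly when s < u1. *)
Lemma level_set_fidelity (u1 f1 i1 i2 : R) :
  i2 = (s < u1)%R%:R -> 0 <= i1 <= 1 ->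
  mu * ((u1 - f1) * (i1 - i2)) + lambda * ((m0 - f1) ^+ 2 + i2 * ((m1 - f1) ^+ 2 - (m0 - f1) ^+ 2))
  <= lambda * ((m0 - f1) ^+ 2 + i1 * ((m1 - f1) ^+ 2 - (m0 - f1) ^+ 2)).
Proof.
move=> i2E i01; rewrite -subr_ge0.
have -> : lambda * ((m0 - f1) ^+ 2 + i1 * ((m1 - f1) ^+ 2 - (m0 - f1) ^+ 2)) -
  (mu * ((u1 - f1) * (i1 - i2)) +
    lambda * ((m0 - f1) ^+ 2 + i2 * ((m1 - f1) ^+ 2 - (m0 - f1) ^+ 2)))
  = mu * ((s - u1) * (i1 - i2)).
  by field; rewrite subr_eq0 gt_eqF.
apply: mulr_ge0; first exact: ltW.
rewrite i2E; have [su|su] := ltP s u1.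
  by apply: mulr_le0; rewrite subr_le0; [exact: ltW|case/andP: i01].
by apply: mulr_ge0; rewrite ?subr_ge0//; case/andP: i01.
Qed.

Lemma level_set_minimizer : E_CV_minimizer Omega f lambda S m0 m1.
Proof.
have pS := level_set_part oO uROF s; split; first exact: pS.
move=> Sigma pSigma.
have [mS SO] := pS; have [mSg SgO] := pSigma.
have [FS iS] := fidelity oO bO mf f01 m0 m1 pS.
have [FSg iSg] := fidelity oO bO mf f01 m0 m1 pSigma.
rewrite /E_CV FS FSg -!EFinM.
(* A competitor of infinite perimeter has infinite energy. Otherwise its perimeter is a real number,
   as [level_set_test] requires. *)
have [PerSg|] := eqVneq (Per Sigma Omega) +oo%E.
  by rewrite PerSg addye ?leey.
rewrite -ltey => PerSg.
have PE : Per Sigma Omega = (fine (Per Sigma Omega))%:E.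
  by rewrite fineK// ge0_fin_numE// TV_ge0.
set P := fine _ in PE; rewrite PE.
have ind (A : set (R * R)) x : 0 <= (\1_A x : R) <= 1.
  by rewrite indicE; case: (_ \in _); rewrite ?lexx ?ler01.
have m1A (A : set (R * R)) : measurable (A : set lp) -> leb_measurable_fun Omega \1_A.
  by move=> mA; exact: measurable_indic.
have mu_u : leb_measurable_fun Omega u by have [[]] := uROF.
have u01 : unit_valued Omega u by have [[]] := uROF.
have PerS : (Per S Omega <= (P + mu * I (fun x => (u x - f x) * (\1_Sigma x - \1_S x))%R)%:E)%E.
  apply: (@TV_le _ _ oO bO _ 1 _ (m1A _ mS)); first by move=> x _; exact: unit_norm.
  move=> phi tphi; rewrite lee_fin.
  by apply: (level_set_test oO bO mf f01 mu0 uROF s01 pSigma _ tphi); rewrite PE.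
apply: le_trans (leeD2r _ PerS) _.
rewrite -!EFinD lee_fin -addrA lerD2l.
have mO := open_leb_measurable oO.
have iK : (@area R).-integrable (Omega : set lp) (EFin \o
    (fun x => (u x - f x) * (\1_Sigma x - \1_S x))).
  apply: (product_integrable oO bO (M := 1) (M' := 1)).
  - exact: measurable_funB mu_u mf.
  - by move=> x Ox; apply: unit_subr_norm; [exact: u01|exact: f01].
  - exact: measurable_funB (m1A _ mSg) (m1A _ mS).
  - by move=> x _; apply: unit_subr_norm; exact: ind.
rewrite -(RintegralZl _ mO iK) -(RintegralZl _ mO iS) -(RintegralZl _ mO iSg).
have jK := integrableZl mO mu iK; have jS := integrableZl mO lambda iS.
rewrite -(RintegralD mO jK jS).
apply: (le_Rintegral mO (integrableD mO jK jS) (integrableZl mO lambda iSg)) => x Ox.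
apply: level_set_fidelity; last exact: ind.
rewrite indicE; have [su|su] := boolP (s < u x); first by rewrite mem_set.
by rewrite memNset//= => -[_]; exact/negP.
Qed.

Lemma level_set_partial_minimizer : m0 = mean f (Omega `\` S) -> m1 = mean f S ->
  E_CV_partial_minimizer Omega f lambda S m0 m1.
Proof.
move=> m0E m1E; have [pS minS] := level_set_minimizer; split => // m0' m1'.
have pD : measurable_part Omega (Omega `\` S).
  split; last exact: subDsetl.
  by apply: measurableD; [exact: open_leb_measurable|have [] := pS].
(* The perimeter does not involve the constants, and each constant enters only one of the two
   fidelity terms. *)
rewrite /E_CV leeD2l// lee_wpmul2l ?lee_fin ?(ltW lambda0)// leeD//.
  by have := mean_minimizes oO bO mf f01 m1' pS; rewrite -m1E.
by have := mean_minimizes oO bO mf f01 m0' pD; rewrite -m0E.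
Qed.

End minimality.

Theorem theorem3p6 (R : realType) (Omega : set (R * R)) (f : R * R -> R)
    (Omega_open : open Omega) (Omega_bounded : bounded_set Omega)
    (Omega_lipschitz : lipschitz_boundary Omega)
    (f_meas : leb_measurable_fun Omega f)
    (f_01 : unit_valued Omega f)
    (mu : R) (mu_gt0 : 0 < mu)
    (u : R * R -> R) (u_ROF : ROF_solution Omega f mu u)
    (m0 m1 : R) (m0_gt0 : 0 < m0) (m0_lt_m1 : m0 < m1) (m1_le1 : m1 <= 1) :
  let Sigma : set (R * R) := [set x | Omega x /\ (m1 + m0) / 2 < u x] in
  let lambda : R := mu / (2 * (m1 - m0)) in
  (0 < area (Sigma : set (leb_plane R)))%E ->
  (area (Sigma : set (leb_plane R)) < area (Omega : set (leb_plane R)))%E ->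
  E_CV_minimizer Omega f lambda Sigma m0 m1 /\
  (m0 = mean f (Omega `\` Sigma) -> m1 = mean f Sigma ->
   E_CV_partial_minimizer Omega f lambda Sigma m0 m1).
Proof.
move=> Sigma lambda _ _; split.
  exact: (level_set_minimizer Omega_open Omega_bounded f_meas f_01 mu_gt0 u_ROF
    m0_gt0 m0_lt_m1 m1_le1).
exact: (level_set_partial_minimizer Omega_open Omega_bounded f_meas f_01 mu_gt0 u_ROF
  m0_gt0 m0_lt_m1 m1_le1).
Qed.
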